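(* For every $\lambda\in\mathbb{X}^+$, the algorithm described in the context, run on input $\lambda$, terminates after a finite number of computations and returns the same element $\mathcal{M}_p(\lambda)\in\mathbb{Z}[\mathbb{X}]^W$ regardless of any choices made at any stage. The element it returns satisfies the good Steinberg multiplication property.
   Context: Let $p$ be a prime and $G$ a simple, simply connected algebraic group over an algebraically closed field of characteristic $p$, with maximal torus $T$, root system $\Phi$, positive roots $\Phi^+$, simple roots $\alpha_1,\dots,\alpha_n$, highest short root $\alpha_0$ (so $\alpha_0^\vee$ is the highest coroot), fundamental dominant weights $\varpi_1,\dots,\varpi_n$, weight lattice $\mathbb{X}$, dominant weights $\mathbb{X}^+$, $\rho=\varpi_1+\cdots+\varpi_n$, Weyl group $W$. For $m\ge0$, $\mathbb{X}_m=\{\sum a_i\varpi_i\mid 0\le a_i<m\}$. The order $\le$: $\mu\le\lambda$ iff $\lambda-\mu$ is a $\mathbb{Z}_{\ge 0}$-combination of simple roots. $\mathbb{Z}[\mathbb{X}]$ is the group ring with basis $e(\mu)$; the orbit sums $s(\mu)=\sum_{\nu\in W\mu}e(\nu)$ ($\mu\in\mathbb{X}^+$) and the Weyl characters $\chi(\lambda)$ ($\lambda\in\mathbb{X}^+$) are two $\mathbb{Z}$-bases of $\mathbb{Z}[\mathbb{X}]^W$. A good filtration character is a nonzero element of $\mathbb{Z}[\mathbb{X}]^W$ with all coefficients nonnegative in the basis of Weyl characters. $\eta\in\mathbb{Z}[\mathbb{X}]^W$ has the good Steinberg multiplication property if $\eta\,\chi((p-1)\rho+p\gamma)$ is a good filtration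 character for all $\gamma\in\mathbb{X}^+$. For $\alpha\in\Phi^+$ and $n\in\mathbb{Z}$ put $s_{\alpha,np}\bullet\lambda=\lambda-(\langle\lambda+\rho,\alpha^\vee\rangle-np)\alpha$. The relation $\lambda\uparrow\mu$ on $\mathbb{X}$ means that $\lambda=\mu$ or there are such affine reflections $s_1,\dots,s_m$ with $\lambda\le s_1\bullet\lambda\le s_2\bullet s_1\bullet\lambda\le\cdots\le s_m\bullet\cdots\bullet s_1\bullet\lambda=\mu$. Algorithm. Input: a weight $\lambda\in\mathbb{X}^+$. Output: $\mathcal{M}_p(\lambda)$. Preliminary steps: (i) let $\Psi^+$ be the set of all $\gamma\in\mathbb{X}^+$ with $(\gamma-\rho)\uparrow(\lambda-\rho)$; (ii) let $m$ be the minimal integer with $\langle\lambda,\alpha_0^\vee\rangle<pm$; (iii) initialize $\mathcal{M}_p(\lambda)=s(\lambda)$. Iterative steps: (1) Choose $\mu\in\Psi^+$ maximal under $\le$ among those elements of $\Psi^+$ for which the multiplicity of $s(\mu)$ in the current $\mathcal{M}_p(\lambda)$ is $0$; if no such $\mu$ exists, stop and return $\mathcal{M}_p(\lambda)$. (2) For each $\gamma\in\mathbb{X}_m$, write $\chi((p-1)\rho+p\gamma)\,\mathcal{M}_p(\lambda)$ in the basis of Weyl characters. (3) Let $x_\mu$ be the least integer appearing in step (2) as the coefficient on a Weyl character of the form $\chi((p-1)\rho+p\gamma+w\mu)$ in the expansion of $\chi((p-1)\rho+p\gamma)\mathcal{M}_p(\lambda)$, over all $w\in W$ and all $\gamma\in\mathbb{X}_m$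 (for which $(p-1)\rho+p\gamma+w\mu$ is dominant). (4) Add $-x_\mu s(\mu)$ to $\mathcal{M}_p(\lambda)$ and return to step (1). *)

(* Defs.v *)
From HB Require Import structures.
From mathcomp Require Import all_boot all_order all_algebra finmap.
From mathcomp Require Import boolp classical_sets functions cardinality fsbigop.
From mathcomp.multinomials Require Import monalg.

Set Implicit Arguments.
Unset Strict Implicit.
Unset Printing Implicit Defensive.

Import Order.TTheory GRing.Theory Num.Theory.

Local Open Scope ring_scope.
Local Open Scope classical_set_scope.

(* A simple, simply connected algebraic group over an algebraically closed    *)
(* field enters the statement only through its characteristic p and its root  *)
(* datum: an irreducible reduced root datum whose simple coroots form a basis *)
(* of the cocharacter lattice, and every such datum arises from such a group. *)
(* The weight lattice is written in the basis of fundamental weights and the  *)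
(* coroot lattice in the dual basis of simple coroots.                        *)
Notation weight n := 'rV[int]_n.
Notation coweight n := 'cV[int]_n.

Definition pairing n (la : weight n) (v : coweight n) : int := (la *m v) 0 0.

(* The reflection la |-> la - <la, v> a, as a matrix acting on row vectors.   *)
Definition reflection_mx n (a : weight n) (v : coweight n) : 'M[int]_n :=
  1%:M - v *m a.

Record root_datum (n : nat) := RootDatum {
  roots : {fset weight n};
  coroot : weight n -> coweight n;
  simple_root : 'I_n -> weight n;
  coroot_inj : {in roots &, injective coroot};
  pairing_coroot : forall a, a \in roots -> pairing a (coroot a) = 2;
  reflection_root : forall a b, a \in roots -> b \in roots ->
    b *m reflection_mx a (coroot a) \in roots;
  reflection_coroot : forall a b, a \in roots -> b \in roots ->
    exists2 c, c \in roots &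
      coroot c = reflection_mx a (coroot a) *m coroot b;
  roots_reduced : forall (a b : weight n) (k l : int),
    a \in roots -> b \in roots -> k != 0 -> k *: a = l *: b ->
    b = a \/ b = - a;
  roots_neq0 : exists a, a \in roots;
  roots_irreducible : forall A : {fset weight n},
    {subset A <= roots} ->
    (forall a b, a \in A -> b \in roots -> b \notin A ->
       pairing a (coroot b) = 0 /\ pairing b (coroot a) = 0) ->
    A = fset0 \/ A = roots;
  simple_root_mem : forall i, simple_root i \in roots;
  simple_root_free : forall c : 'I_n -> int,
    \sum_i c i *: simple_root i = 0 -> forall i, c i = 0;
  root_simple_sum : forall a, a \in roots ->
    exists c : 'I_n -> nat,
      a = \sum_i simple_root i *+ c i \/ a = - \sum_i simple_root i *+ c i;
  coroot_simple : forall i, coroot (simple_root i) = delta_mx i 0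
}.

Definition fundamental_weight n (i : 'I_n) : weight n := delta_mx 0 i.

Definition rho n : weight n := \sum_(i < n) fundamental_weight i.

Definition dominant n : set (weight n) := [set la | forall i, 0 <= la 0 i].

Definition restricted n (m : int) : set (weight n) :=
  [set la | exists2 a : 'I_n -> int,
     forall i, 0 <= a i < m & la = \sum_i a i *: fundamental_weight i].

(* The group ring Z[X] of the weight lattice. The ring structure of {malg} is *)
(* restricted to monoids in which x y = 1 forces x = y = 1, which excludes X; *)
(* only its additive structure can be used here.                              *)
Notation group_ring n := {malg int[weight n]}.

Definition expo n (mu : weight n) : group_ring n := << mu >>.

Definition gmul n (f g : group_ring n) : group_ring n :=
  \sum_(x <- msupp f) \sum_(y <- msupp g) (f@_x * g@_y) *: expo (x + y).

Definition is_least (S : set int) (x : int) : Prop :=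
  S x /\ forall y, S y -> x <= y.

(* [c] lists the coefficients of [eta] on the family [b la], la dominant.     *)
Definition is_expansion n (b : weight n -> group_ring n) (eta c : group_ring n)
    : Prop :=
  {in msupp c, forall la, dominant la} /\
  eta = \sum_(la <- msupp c) c@_la *: b la.

Definition basis_coef n (b : weight n -> group_ring n) (eta : group_ring n)
    (la : weight n) : int :=
  (xget 0 [set c | is_expansion b eta c])@_la.

Section RootDatum.
Variables (n : nat) (D : root_datum n).
Implicit Types (la mu ga : weight n) (eta M N : group_ring n).

Definition dominance la mu : Prop :=
  exists c : 'I_n -> nat, mu - la = \sum_i simple_root D i *+ c i.

Definition positive_roots : set (weight n) :=
  [set a | a \in roots D /\ dominance 0 a].

(* Up to a scalar, the unique Weyl group invariant positive definite form on  *)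
(* an irreducible root system; it is used to compare root lengths.            *)
Definition root_normsq (a : weight n) : int :=
  \sum_(b <- roots D) pairing a (coroot D b) ^+ 2.

Definition short_root : set (weight n) :=
  [set a | a \in roots D /\
     forall b, b \in roots D -> root_normsq a <= root_normsq b].

Definition highest_short_root (a : weight n) : Prop :=
  short_root a /\ forall b, short_root b -> dominance b a.

Definition root_reflection (a : weight n) : 'M[int]_n :=
  reflection_mx a (coroot D a).

Inductive weyl : set 'M[int]_n :=
| weyl_id : weyl 1%:M
| weyl_mul a w : a \in roots D -> weyl w -> weyl (w *m root_reflection a).

Definition weyl_orbit mu : set (weight n) := [set mu *m w | w in weyl].

Definition orbit_sum mu : group_ring n :=
  \sum_(nu \in weyl_orbit mu) expo nu.

Definition weyl_invariant : set (group_ring n) :=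
  [set eta | forall w, weyl w -> forall mu, eta@_(mu *m w) = eta@_mu].

Definition alternating_sum mu : group_ring n :=
  \sum_(w \in weyl) \det w *: expo (mu *m w).

(* Weyl's character formula: chi(la) is the quotient of the alternating sums  *)
(* at la + rho and rho in the domain Z[X].                                    *)
Definition weyl_char la : group_ring n :=
  xget 0 [set chi | gmul chi (alternating_sum (rho n)) =
                    alternating_sum (la + rho n)].

Definition good_filtration_char : set (group_ring n) :=
  [set eta | [/\ eta != 0, weyl_invariant eta &
     forall la, dominant la -> 0 <= basis_coef weyl_char eta la]].

Section Prime.
Variable p : nat.

Definition steinberg_weight ga : weight n :=
  rho n *+ p.-1 + ga *+ p.

Definition good_steinberg_multiplication : set (group_ring n) :=
  [set eta | weyl_invariant eta /\ forall ga, dominant ga ->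
     good_filtration_char (gmul eta (weyl_char (steinberg_weight ga)))].

Definition affine_dot (a : weight n) (k : int) la : weight n :=
  la - (pairing (la + rho n) (coroot D a) - k * p%:Z) *: a.

Inductive uparrow : weight n -> weight n -> Prop :=
| uparrow_refl la : uparrow la la
| uparrow_step la mu a (k : int) :
    positive_roots a -> dominance la (affine_dot a k la) ->
    uparrow (affine_dot a k la) mu -> uparrow la mu.

Variable la : weight n.

Definition Psi : set (weight n) :=
  [set ga | dominant ga /\ uparrow (ga - rho n) (la - rho n)].

(* One iteration of the algorithm chooses a maximal mu among the weights of   *)
(* Psi missing from M, computes the minimum x of the inspected coefficients   *)
(* and replaces M by M - x s(mu). The choice makes this a relation.           *)
Definition missing M : set (weight n) :=
  [set mu | Psi mu /\ basis_coef orbit_sum M mu = 0].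

Definition choosable M : set (weight n) :=
  [set mu | missing M mu /\
     forall nu, missing M nu -> dominance mu nu -> nu = mu].

Definition inspected_coefs (m : int) M mu : set int :=
  [set x | exists ga w, [/\ restricted m ga, weyl w,
     dominant (steinberg_weight ga + mu *m w) &
     x = basis_coef weyl_char (gmul (weyl_char (steinberg_weight ga)) M)
           (steinberg_weight ga + mu *m w)]].

Variable a0 : weight n.

Definition level (m : int) : Prop :=
  is_least [set k | pairing la (coroot D a0) < p%:Z * k] m.

Definition iteration_at mu M M' : Prop :=
  exists m x, [/\ level m, is_least (inspected_coefs m M mu) x &
    M' = M - x *: orbit_sum mu].

Definition iteration M M' : Prop :=
  exists2 mu, choosable M mu & iteration_at mu M M'.

Inductive reachable : group_ring n -> Prop :=
| reachable_init : reachable (orbit_sum la)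
| reachable_next M M' : reachable M -> iteration M M' -> reachable M'.

(* There is no infinite execution, the iteration can be completed for every   *)
(* choice of mu, and all the sets to be searched are finite.                  *)
Definition algorithm_terminates : Prop :=
  [/\ Acc (fun M' M => iteration M M') (orbit_sum la),
      forall M mu, reachable M -> choosable M mu ->
        exists M', iteration_at mu M M',
      finite_set Psi, finite_set weyl &
      forall m, level m -> finite_set (@restricted n m)].

(* The algorithm stops when no mu remains, not merely when none is maximal.   *)
Definition algorithm_returns N : Prop :=
  reachable N /\ missing N = set0.

End Prime.
End RootDatum.

(* Main.v *)
Require Import Defs.
From HB Require Import structures.
From mathcomp Require Import all_boot all_order all_algebra finmap.
From mathcomp Require Import boolp classical_sets functions cardinality fsbigop.
From mathcomp.multinomials Require Import monalg.
From mathcomp Require Import zify ring.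
Import Defs.

Set Implicit Arguments.
Unset Strict Implicit.
Unset Printing Implicit Defensive.
Import Order.TTheory GRing.Theory Num.Theory.
Local Open Scope ring_scope.
Local Open Scope classical_set_scope.

(** An invariant element M is treated as a function on weights. Put c = p
    (ga + rho), so that c - rho is the weight (p - 1) rho + p ga.
    Multiplying M chi(c - rho) by the alternating sum of rho gives M times
    the alternating sum of c; comparing coefficients shows that chi(t - rho)
    occurs in M chi(c - rho) with coefficient sum_u det(u) M(t u - c), u in
    the Weyl group (brauer). For t = c + y the term of u = 1 is M(y), and
    all other terms are values of M at weights strictly above y
    (brauer_term). The coefficients inspected at mu are therefore M(mu) plus
    quantities that depend only on the values of M above mu. Subtracting x
    s(mu) makes their minimum 0, does not disturb the weights treated
    before, and M is determined from the top downwards by the condition that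
    all these minima are 0 (inspected_shift, final_unique). The restriction
    to ga in X_m is harmless, since truncating ga changes no term
    (brauer_coef_reduce); this uses that the coroot of a0 is the highest
    coroot.

    The algorithm stops because x is never 0 (least_negative). When all
    coordinates of ga but the i-th are large, only the terms of 1 and of the
    i-th simple reflection remain, and if M(mu) = 0 the coefficient is -
    M(nu), where nu is the image of mu under an affine reflection away from
    0. So it suffices that every weight mu of Psi other than la has such a
    reflection nu whose dominant conjugate is again in Psi, the coefficients
    above mu being positive already. In other words, the up-arrow order on
    dominant weights must coincide with the order linked, generated by
    reflections away from 0 and Weyl group moves (PsiP).

    Both orders consist of affine reflections away from a base point: a
    point far away in the antidominant chamber for the up-arrow order, a
    point close to 0 for linked. The base point is moved from the first to
    the second, crossing one hyperplane at a time. At each crossing a chain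
    between dominant weights is folded along the hyperplane, which yields a
    chain for the new base point (crossing_fold, before_linked). *)

(** Equal matrix entries occur over several convertible presentations of the
    ring of integers, which lia takes for distinct unknowns: they are
    brought to one form, then generalized. *)
Ltac entry_lia := intros;
  repeat match goal with
  | H : context [@fun_of_matrix ?R ?a ?b ?x ?i ?j] |- _ =>
    assert_fails (constr_eq R int);
    change (@fun_of_matrix R a b x i j) with (@fun_of_matrix int a b x i j) in H
  | |- context [@fun_of_matrix ?R ?a ?b ?x ?i ?j] =>
    assert_fails (constr_eq R int);
    change (@fun_of_matrix R a b x i j) with (@fun_of_matrix int a b x i j)
  end;
  repeat match goal with
  | H : context [@fun_of_matrix int ?a ?b ?x ?i ?j] |- _ =>
    let y := fresh in set (y := @fun_of_matrix int a b x i j) in *; clearbody y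
  | |- context [@fun_of_matrix int ?a ?b ?x ?i ?j] =>
    let y := fresh in set (y := @fun_of_matrix int a b x i j) in *; clearbody y
  end; cbv beta in *; lia.

(** * The pairing of weights and coweights *)

Section Pairing.
Variable n : nat.
Implicit Types (x y : weight n) (u v : coweight n).

Lemma pairingDl x y v : pairing (x + y) v = pairing x v + pairing y v.
Proof. by rewrite /pairing mulmxDl mxE. Qed.
Lemma pairingNl x v : pairing (- x) v = - pairing x v.
Proof. by rewrite /pairing mulNmx mxE. Qed.
Lemma pairingBl x y v : pairing (x - y) v = pairing x v - pairing y v.
Proof. by rewrite pairingDl pairingNl. Qed.
Lemma pairingZl c x v : pairing (c *: x) v = c * pairing x v.
Proof. by rewrite /pairing -scalemxAl mxE. Qed.
Lemma pairing0l v : pairing 0 v = 0.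
Proof. by rewrite /pairing mul0mx mxE. Qed.
Lemma pairingDr x u v : pairing x (u + v) = pairing x u + pairing x v.
Proof. by rewrite /pairing mulmxDr mxE. Qed.
Lemma pairingNr x v : pairing x (- v) = - pairing x v.
Proof. by rewrite /pairing mulmxN mxE. Qed.
Lemma pairingBr x u v : pairing x (u - v) = pairing x u - pairing x v.
Proof. by rewrite pairingDr pairingNr. Qed.
Lemma pairingZr c x v : pairing x (c *: v) = c * pairing x v.
Proof. by rewrite /pairing -scalemxAr mxE. Qed.
Lemma pairing_mulmx x (w : 'M_n) v : pairing (x *m w) v = pairing x (w *m v).
Proof. by rewrite /pairing mulmxA. Qed.
Lemma pairing_delta x i : pairing x (delta_mx i 0) = x 0 i.
Proof.
rewrite /pairing mxE (bigD1 i) //= mxE !eqxx mulr1 big1 ?addr0 // => j ji.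
by rewrite mxE (negPf ji) mulr0.
Qed.
Lemma pairing_sum x v : pairing x v = \sum_i x 0 i * v i 0.
Proof. by rewrite /pairing mxE. Qed.

Lemma pairing_fundamental i v : pairing (delta_mx 0 i) v = v i 0.
Proof.
rewrite pairing_sum (bigD1 i) //= mxE !eqxx mul1r big1 ?addr0 // => j ji.
by rewrite mxE (negPf ji) andbF mul0r.
Qed.

Lemma mul_reflection x a v : x *m reflection_mx a v = x - pairing x v *: a.
Proof.
rewrite /reflection_mx mulmxBr mulmx1 mulmxA; congr (_ - _).
by rewrite {1}[x *m v]mx11_scalar mul_scalar_mx.
Qed.
Lemma reflection_mulr a v u : reflection_mx a v *m u = u - pairing a u *: v.
Proof.
rewrite /reflection_mx mulmxBl mul1mx -mulmxA; congr (_ - _).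
by rewrite {1}[a *m u]mx11_scalar mul_mx_scalar.
Qed.
(** The matrix determinant lemma: both matrices are Schur complements of the
    same block matrix. *)
Lemma det_reflection a v : \det (reflection_mx a v) = 1 - pairing a v.
Proof.
pose L := @block_mx int 1 n 1 n 1%:M a 0 1%:M.
have e1 : L *m block_mx (1 - pairing a v)%:M 0 v 1%:M = block_mx 1%:M a v 1%:M.
  rewrite mulmx_block !mul1mx !mul0mx !mulmx1 !add0r; congr block_mx.
  by rewrite [a *m v]mx11_scalar -raddfD /= subrK.
have e2 : block_mx 1%:M 0 v 1%:M *m block_mx 1%:M a 0 (reflection_mx a v) =
    block_mx 1%:M a v 1%:M.
  by rewrite mulmx_block !mul1mx !mul0mx !mulmx1 !addr0 addrC subrK.
have := congr1 determinant (etrans e1 (esym e2)).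
rewrite !det_mulmx !det_ublock !det_lblock !det1 !mul1r det_scalar1 mulr1.
by move->.
Qed.
End Pairing.

(** * The invariant form and the Weyl group *)

Section Form.
Variables (n : nat) (D : root_datum n).
Implicit Types (x y z : weight n) (a b : weight n).
Local Notation "a '^v'" := (coroot D a) (at level 2, format "a '^v'").
Local Notation s_ a := (root_reflection D a).
Local Notation al := (simple_root D).

(** The polarization of root_normsq, hence an invariant form; since its
    definition involves all coroots, it is positive definite over the
    integers and bounds every coordinate of a weight. *)
Definition dot x y : int := \sum_(b <- roots D) pairing x b^v * pairing y b^v.

Lemma dotC x y : dot x y = dot y x.
Proof. by apply: eq_bigr => b _; rewrite mulrC. Qed.
Lemma dotDl x y z : dot (x + y) z = dot x z + dot y z.
Proof. by rewrite -big_split; apply: eq_bigr => b _; rewrite pairingDl mulrDl. Qed.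
Lemma dotZl c x z : dot (c *: x) z = c * dot x z.
Proof. by rewrite big_distrr; apply: eq_bigr => b _ /=; rewrite pairingZl mulrA. Qed.
Lemma dotNl x z : dot (- x) z = - dot x z.
Proof. by rewrite -scaleN1r dotZl mulN1r. Qed.
Lemma dotBl x y z : dot (x - y) z = dot x z - dot y z.
Proof. by rewrite dotDl dotNl. Qed.
Lemma dotDr x y z : dot x (y + z) = dot x y + dot x z.
Proof. by rewrite !(dotC x) dotDl. Qed.
Lemma dotZr c x z : dot x (c *: z) = c * dot x z.
Proof. by rewrite !(dotC x) dotZl. Qed.
Lemma dotNr x z : dot x (- z) = - dot x z.
Proof. by rewrite !(dotC x) dotNl. Qed.
Lemma dotBr x y z : dot x (y - z) = dot x y - dot x z.
Proof. by rewrite dotDr dotNr. Qed.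
Lemma dot0r x : dot x 0 = 0.
Proof. by rewrite -(scale0r 0) dotZr mul0r. Qed.
Lemma dot_sumr x I r (P : pred I) (F : I -> weight n) :
  dot x (\sum_(i <- r | P i) F i) = \sum_(i <- r | P i) dot x (F i).
Proof. by apply: big_morph => [y z|]; rewrite ?dotDr ?dot0r. Qed.

Lemma dot_ge0 x : 0 <= dot x x.
Proof. by apply: sumr_ge0 => b _; rewrite -expr2 sqr_ge0. Qed.

Lemma le_sqr_dot x a : a \in roots D -> pairing x a^v ^+ 2 <= dot x x.
Proof.
move=> aR; rewrite /dot (big_rem a) //= expr2 lerDl.
by apply: sumr_ge0 => b _; rewrite -expr2 sqr_ge0.
Qed.

Lemma le_sqr_coord x i : x 0 i ^+ 2 <= dot x x.
Proof.
by have := le_sqr_dot x (simple_root_mem D i); rewrite coroot_simple pairing_delta.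
Qed.

Lemma dot_eq0 x : dot x x = 0 -> x = 0.
Proof.
move=> x0; apply/rowP => i; rewrite mxE; apply/eqP.
by rewrite -sqrf_eq0 eq_le sqr_ge0 andbT -x0 le_sqr_coord.
Qed.

Lemma dot_gt0 x : x != 0 -> 0 < dot x x.
Proof. by move=> x0; rewrite lt_def dot_ge0 andbT; apply: contraNneq x0 => /dot_eq0->. Qed.

Lemma refl_mul x a : x *m s_ a = x - pairing x a^v *: a.
Proof. exact: mul_reflection. Qed.

Lemma reflK a : a \in roots D -> s_ a *m s_ a = 1%:M.
Proof.
move=> aR; apply/row_matrixP => i; rewrite !rowE mulmxA 2!refl_mul mulmx1.
rewrite pairingBl pairingZl pairing_coroot // -addrA -opprD -scalerDl.
by rewrite mulr_natr mulr2n addrA subrr scale0r subr0.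
Qed.

(** Reflections permute the coroots; this is what makes the form invariant. *)
Lemma perm_corefl a : a \in roots D ->
  perm_eq [seq s_ a *m b^v | b <- roots D] [seq b^v | b <- roots D].
Proof.
move=> aR.
have ui : uniq [seq b^v | b <- roots D].
  by rewrite map_inj_in_uniq ?fset_uniq // => x y xR yR; apply: coroot_inj.
have u' : uniq [seq s_ a *m b^v | b <- roots D].
  have inj : injective (mulmx (s_ a) : coweight n -> _).
    by apply: (can_inj (g := mulmx (s_ a))) => v; rewrite mulmxA reflK ?mul1mx.
  by rewrite (map_comp (mulmx (s_ a)) (coroot D)) map_inj_uniq.
apply: uniq_perm => //; apply: (uniq_min_size u' _ _).2.
  move=> v /mapP[b bR ->]; have [c cR e] := reflection_coroot aR bR.
  by apply/mapP; exists c.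
by rewrite !size_map.
Qed.

Lemma dot_refl x y a : a \in roots D -> dot (x *m s_ a) (y *m s_ a) = dot x y.
Proof.
move=> aR.
transitivity (\sum_(v <- [seq b^v | b <- roots D]) pairing x v * pairing y v).
  rewrite -(perm_big _ (perm_corefl aR)) big_map.
  by apply: eq_bigr => b _; rewrite !pairing_mulmx.
by rewrite big_map.
Qed.

Lemma root_neq0 a : a \in roots D -> a != 0.
Proof.
by move=> aR; apply/eqP => a0; have := pairing_coroot aR; rewrite a0 pairing0l.
Qed.

Lemma dot_root_gt0 a : a \in roots D -> 0 < dot a a.
Proof. by move=> /root_neq0/dot_gt0. Qed.

Lemma refl_self a : a \in roots D -> a *m s_ a = - a.
Proof.
move=> aR; rewrite refl_mul pairing_coroot // scaler_nat mulr2n opprD addrA.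
by rewrite subrr sub0r.
Qed.

Lemma rootN a : a \in roots D -> - a \in roots D.
Proof. by move=> aR; rewrite -refl_self //; apply: reflection_root. Qed.

(** Invariance under the reflection in a identifies a^v with 2a/(a, a), so
    signs of pairings are signs of scalar products. *)
Lemma pairing_dot x a : a \in roots D -> pairing x a^v * dot a a = 2 * dot x a.
Proof.
move=> aR; have := dot_refl x a aR.
rewrite refl_self // refl_mul dotBl dotZl !dotNr.
lia.
Qed.

Lemma pairing_gt0 x a : a \in roots D -> (0 < pairing x a^v) = (0 < dot x a).
Proof.
move=> aR; rewrite -(pmulr_lgt0 _ (dot_root_gt0 aR)) pairing_dot //.
by rewrite pmulr_rgt0.
Qed.
Lemma pairing_ge0 x a : a \in roots D -> (0 <= pairing x a^v) = (0 <= dot x a).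
Proof.
move=> aR; rewrite -(pmulr_lge0 _ (dot_root_gt0 aR)) pairing_dot //.
by rewrite pmulr_rge0.
Qed.

Lemma weyl_refl a : a \in roots D -> weyl D (s_ a).
Proof. by move=> aR; rewrite -[s_ a]mul1mx; apply: weyl_mul => //; constructor. Qed.

Lemma weylM w1 w2 : weyl D w1 -> weyl D w2 -> weyl D (w1 *m w2).
Proof.
move=> W1; elim=> [|a w aR Ww IH]; first by rewrite mulmx1.
by rewrite mulmxA; apply: weyl_mul.
Qed.

Lemma weyl_unit w : weyl D w -> w \in unitmx.
Proof.
elim=> [|a {}w aR _ IH]; first exact: unitmx1.
by rewrite unitmx_mul IH /=; case: (mulmx1_unit (reflK aR)).
Qed.

Lemma weylV w : weyl D w -> weyl D (invmx w).
Proof.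
elim=> [|a {}w aR Ww IH]; first by rewrite invmx1; constructor.
suff -> : invmx (w *m s_ a) = s_ a *m invmx w by apply: weylM => //; apply: weyl_refl.
have U : w *m s_ a \in unitmx by apply/weyl_unit/weyl_mul.
rewrite -[RHS]mul1mx -(mulVmx U) -!mulmxA; rewrite [s_ a *m (_ *m _)]mulmxA.
by rewrite reflK // mul1mx mulmxV ?weyl_unit // mulmx1.
Qed.

Lemma weylK w x : weyl D w -> x *m w *m invmx w = x.
Proof. by move/weyl_unit=> U; rewrite mulmxK. Qed.
Lemma weylVK w x : weyl D w -> x *m invmx w *m w = x.
Proof. by move/weyl_unit=> U; rewrite mulmxKV. Qed.

Lemma dot_weyl w x y : weyl D w -> dot (x *m w) (y *m w) = dot x y.
Proof.
by elim=> [|a {}w aR _ IH]; rewrite ?mulmx1 // !mulmxA dot_refl.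
Qed.

Lemma root_weyl w a : weyl D w -> a \in roots D -> a *m w \in roots D.
Proof.
move=> + aR; elim=> [|b {}w bR _ IH]; first by rewrite mulmx1.
by rewrite mulmxA; apply: reflection_root.
Qed.

(** The root datum only says that a coroot is sent to some coroot; by
    pairing_dot it has to be the coroot of the image of the root. *)
Lemma pairing_weyl w x a : weyl D w -> a \in roots D ->
  pairing (x *m w) (a *m w)^v = pairing x a^v.
Proof.
move=> Ww aR; have aw := root_weyl Ww aR.
apply: (mulIf (lt0r_neq0 (dot_root_gt0 aw))).
by rewrite pairing_dot // !dot_weyl // pairing_dot.
Qed.

Lemma pairing_eqP (u v : coweight n) : (forall x, pairing x u = pairing x v) -> u = v.
Proof.
move=> e; apply/colP => i; have := e (delta_mx 0 i).
by rewrite !pairing_fundamental.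
Qed.

Lemma coroot_weyl w a : weyl D w -> a \in roots D -> w *m (a *m w)^v = a^v.
Proof.
by move=> Ww aR; apply: pairing_eqP => x; rewrite -pairing_mulmx pairing_weyl.
Qed.

Lemma corootN a : a \in roots D -> (- a)^v = - a^v.
Proof.
move=> aR; apply: pairing_eqP => x; have := pairing_weyl (x *m s_ a) (weyl_refl aR) aR.
rewrite refl_self // -mulmxA reflK // mulmx1 => ->.
by rewrite refl_mul pairingBl pairingZl pairing_coroot // pairingNr; lia.
Qed.

Lemma det_refl a : a \in roots D -> \det (s_ a) = -1.
Proof. by move=> aR; rewrite det_reflection pairing_coroot. Qed.

Lemma det_weyl w : weyl D w -> \det w = 1 \/ \det w = -1.
Proof.
elim=> [|a {}w aR _ IH]; first by left; rewrite det1.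
by rewrite det_mulmx det_refl // mulrN1; case: IH => ->; [right|left]; rewrite ?opprK.
Qed.

Lemma det_weylV w : weyl D w -> \det (invmx w) = \det w.
Proof.
move=> Ww; rewrite det_inv; by case: (det_weyl Ww) => ->.
Qed.

End Form.

(** * Dominant weights and simple reflections *)

Section Weyl.
Variables (n : nat) (D : root_datum n).
Implicit Types (x y z : weight n) (a b : weight n).
Local Notation "a '^v'" := (coroot D a) (at level 2, format "a '^v'").
Local Notation s_ a := (root_reflection D a).
Local Notation al := (simple_root D).
Local Notation dot := (dot D).

Definition strictly_dominant x : Prop := forall i, 0 < x 0 i.

Lemma strictly_dominantW x : strictly_dominant x -> dominant x.
Proof. by move=> h i; apply: ltW. Qed.

Lemma rho_coord i : (rho n) 0 i = 1.
Proof.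
rewrite /rho summxE (bigD1 i) //= mxE !eqxx big1 ?addr0 // => j ji.
by rewrite mxE eq_sym (negPf ji) andbF.
Qed.

Lemma rho_strict : strictly_dominant (rho n).
Proof. by move=> i; rewrite rho_coord. Qed.

Lemma dominant_rho x : strictly_dominant (x + rho n) <-> dominant x.
Proof. by split => h i; have := h i; rewrite mxE rho_coord; entry_lia. Qed.

Lemma simple_natsum (c : 'I_n -> nat) :
  \sum_i al i *+ c i = \sum_i (c i)%:Z *: al i.
Proof. by apply: eq_bigr => i _; rewrite -[(c i)%:Z]natz scaler_nat. Qed.

Lemma dominance_refl x : dominance D x x.
Proof. by exists (fun=> 0%N); rewrite subrr big1. Qed.

Lemma dominance_trans y x z : dominance D x y -> dominance D y z -> dominance D x z.
Proof.
move=> [c e] [d f]; exists (fun i => d i + c i)%N.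
have -> : z - x = (z - y) + (y - x) by rewrite addrA subrK.
by rewrite e f -big_split; apply: eq_bigr => i _; rewrite mulrnDr.
Qed.

Lemma dominance_anti x y : dominance D x y -> dominance D y x -> x = y.
Proof.
move=> [c e] [d f]; have : \sum_i (c i + d i)%N%:Z *: al i = 0.
  rewrite -simple_natsum.
  under eq_bigr do rewrite mulrnDr.
  by rewrite big_split /= -e -f addrA subrK subrr.
move/simple_root_free => z; apply/esym/eqP; rewrite -subr_eq0 e big1 // => i _.
by have /eqP := z i; rewrite eqz_nat addn_eq0 => /andP[/eqP-> _].
Qed.

Lemma dominanceDr z x y : dominance D x y <-> dominance D (x + z) (y + z).
Proof.
by split=> -[c e]; exists c; rewrite -e opprD addrACA ?(addrN, subrr) addr0.
Qed.

Lemma dominance_simple x i c : 0 <= c -> dominance D x (x + c *: al i).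
Proof.
case: c => // c _; exists (fun j => if j == i then c else 0%N).
rewrite addrC addrA addNr add0r (bigD1 i) //= eqxx big1 ?addr0.
  by rewrite -scaler_nat natz.
by move=> j /negPf->.
Qed.

Lemma dominance_sub_ge0 x y : dominance D x y <-> dominance D 0 (y - x).
Proof. by rewrite (dominanceDr (- x)) subrr. Qed.

Lemma dominanceZ c a : 0 <= c -> dominance D 0 a -> dominance D 0 (c *: a).
Proof.
case: c => // c _ [d]; rewrite subr0 => ->; exists (fun i => c * d i)%N.
rewrite subr0 -[Posz c]natz scaler_nat -sumrMnl; apply: eq_bigr => i _.
by rewrite mulnC mulrnA.
Qed.

Lemma simple_dot x i : 2 * dot x (al i) = x 0 i * dot (al i) (al i).
Proof.
rewrite -pairing_dot ?coroot_simple ?pairing_delta //.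
exact: simple_root_mem.
Qed.

Lemma dot_simple_ge0 x i : dominant x -> 0 <= dot x (al i).
Proof.
move=> /(_ i); rewrite -(pairing_delta x i) -(coroot_simple D).
by rewrite pairing_ge0 // simple_root_mem.
Qed.

Lemma dot_simple_gt0 x i : 0 < x 0 i -> 0 < dot x (al i).
Proof.
rewrite -(pairing_delta x i) -(coroot_simple D).
by rewrite pairing_gt0 // simple_root_mem.
Qed.

Lemma dominance_dot z x y : dominant z -> dominance D x y -> dot z x <= dot z y.
Proof.
move=> zd [c e]; rewrite -subr_ge0 -dotBr e simple_natsum dot_sumr.
by apply: sumr_ge0 => i _; rewrite dotZr mulr_ge0 // dot_simple_ge0.
Qed.

Lemma dominance_dot_lt z x y : strictly_dominant z -> dominance D x y -> x <> y ->
  dot z x < dot z y.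
Proof.
move=> zs [c e] ne; rewrite -subr_gt0 -dotBr e simple_natsum dot_sumr.
have ge0 i : 0 <= dot z ((c i)%:Z *: al i).
  by rewrite dotZr mulr_ge0 // dot_simple_ge0 //; apply: strictly_dominantW.
rewrite lt_def sumr_ge0 // andbT; apply/eqP => /eqP.
rewrite psumr_eq0 // => /allP h; apply: ne; apply/esym/eqP.
rewrite -subr_eq0 e big1 // => i _; have := h i (mem_index_enum i).
rewrite dotZr mulf_eq0 orbC gt_eqF ?dot_simple_gt0 //= => /eqP [->].
by rewrite mulr0n.
Qed.

Lemma positive_neg a : a \in roots D -> positive_roots D a \/ positive_roots D (- a).
Proof.
move=> aR; have [c [e|e]] := root_simple_sum aR; [left|right]; split; rewrite ?rootN //;
  by exists c; rewrite subr0 e ?opprK.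
Qed.

Lemma positive_asym a : positive_roots D a -> ~ positive_roots D (- a).
Proof.
move=> [aR h] [_ h']; have /eqP := root_neq0 aR; apply; apply: dominance_anti => //.
by rewrite (dominanceDr (- a)) subrr add0r.
Qed.

Lemma positive_root a : positive_roots D a -> a \in roots D.
Proof. by case. Qed.

Lemma positive_simple i : positive_roots D (al i).
Proof.
split; first exact: simple_root_mem.
by rewrite -[al i]add0r -[al i]scale1r; apply: dominance_simple.
Qed.

Lemma positive_pairing x a : dominant x -> positive_roots D a -> 0 <= pairing x a^v.
Proof.
move=> xd [aR /(dominance_dot xd)]; by rewrite dot0r pairing_ge0.
Qed.

Lemma positive_pairing_gt x a :
  strictly_dominant x -> positive_roots D a -> 0 < pairing x a^v.
Proof.
move=> xd [aR /(dominance_dot_lt xd)]; rewrite dot0r pairing_gt0 //; apply.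
by apply/eqP; rewrite eq_sym (root_neq0 aR).
Qed.

Lemma simple_refl x i : x *m s_(al i) = x - x 0 i *: al i.
Proof. by rewrite refl_mul coroot_simple pairing_delta. Qed.

(** A positive root other than al i has, by reducedness, a positive
    coefficient on another simple root, and the reflection does not change
    that coefficient. *)
Lemma positive_simple_refl b i :
  positive_roots D b -> b <> al i -> positive_roots D (b *m s_(al i)).
Proof.
move=> bp bi; have bR := positive_root bp.
have bsR : b *m s_(al i) \in roots D by apply/reflection_root/bR/simple_root_mem.
case: (positive_neg bsR) => // -[_ [d]]; rewrite subr0 simple_refl opprB => ed.
case: (bp) => _ [c]; rewrite subr0 => ec.
have : \sum_j ((c j + d j)%N%:Z - b 0 i * (j == i)%:Z) *: al j = 0.
  under eq_bigr do rewrite scalerBl.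
  rewrite sumrB -simple_natsum.
  under eq_bigr do rewrite mulrnDr.
  rewrite big_split /= -ec -ed (bigD1 i) //= eqxx mulr1 big1 => [|j /negPf ->].
    by rewrite addr0 addrCA subrr addr0 subrr.
  by rewrite mulr0 scale0r.
move/simple_root_free => e0.
have ci j : j != i -> c j = 0%N.
  move=> ji; have := e0 j; rewrite (negPf ji) mulr0 subr0 => /eqP.
  by rewrite eqz_nat addn_eq0 => /andP[/eqP].
have eb : 1 *: b = (c i)%:Z *: al i.
  rewrite scale1r ec (bigD1 i) //= big1 ?addr0 => [|j /ci->//].
  by rewrite -[(c i)%:Z]natz scaler_nat.
case: (roots_reduced bR (simple_root_mem D i) (oner_neq0 _) eb) => h.
  by case: bi.
by have := positive_simple i; rewrite h => /(positive_asym bp).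
Qed.

Definition word (s : seq 'I_n) : 'M[int]_n := foldr (fun i w => s_(al i) *m w) 1%:M s.

Lemma word_cat s t : word (s ++ t) = word s *m word t.
Proof. by elim: s => [|i s IH] /=; rewrite ?mul1mx // IH mulmxA. Qed.
Lemma word_rcons s i : word (rcons s i) = word s *m s_(al i).
Proof. by rewrite -cats1 word_cat /= mulmx1. Qed.
Lemma weyl_word s : weyl D (word s).
Proof.
elim: s => [|i s IH] /=; first by constructor.
by apply: weylM => //; apply/weyl_refl/simple_root_mem.
Qed.

Lemma wordV s : invmx (word s) = word (rev s).
Proof.
suff e : word s *m word (rev s) = 1%:M.
  have U := weyl_unit (weyl_word s).
  by rewrite -[RHS]mul1mx -(mulVmx U) -mulmxA e mulmx1.
elim: s => [|i s IH] /=; first by rewrite mulmx1.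
rewrite rev_cons word_rcons !mulmxA -(mulmxA (s_ _) (word s)) IH mulmx1.
by rewrite reflK // simple_root_mem.
Qed.

Lemma refl_conj a w : weyl D w -> a \in roots D -> s_(a *m w) = invmx w *m s_ a *m w.
Proof.
move=> Ww aR; apply/row_matrixP => i; rewrite !rowE.
move: (delta_mx _ _) => x; rewrite !mulmxA !refl_mul mulmxBl (weylVK _ Ww).
by rewrite -(pairing_weyl (x *m invmx w) Ww aR) (weylVK _ Ww) scalemxAl.
Qed.

Lemma reflN a : a \in roots D -> s_(- a) = s_ a.
Proof.
move=> aR; apply/row_matrixP => i; rewrite !rowE !refl_mul corootN //.
by rewrite pairingNr scaleNr scalerN opprK.
Qed.

(** Induction on the scalar product with rho: some simple root has a
    positive scalar product with a, and reflecting in it lowers that number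
    while keeping a positive. *)
Lemma positive_root_word a : positive_roots D a -> exists s i, a = al i *m word s.
Proof.
have [m] := ubnP `|dot (rho n) a|; elim: m a => // m IH a lt_m ap.
have aR := positive_root ap; case: (ap) => _ [c]; rewrite subr0 => ec.
have [i di] : exists i, 0 < dot a (al i).
  apply/existsP; apply: contraT; rewrite negb_exists => /forallP h.
  have := dot_root_gt0 aR; rewrite {2}ec simple_natsum dot_sumr ltNge.
  rewrite sumr_le0 // => i _; rewrite dotZr mulr_ge0_le0 //.
  by have := h i; rewrite -leNgt.
have gt0 b : positive_roots D b -> 0 < dot (rho n) b.
  by move=> bp; have := positive_pairing_gt rho_strict bp; rewrite pairing_gt0 //; case: bp.
case: (eqVneq a (al i)) => [->|/eqP ai]; first by exists [::], i; rewrite mulmx1.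
have bp := positive_simple_refl ap ai.
have [|s [j e]] := IH _ _ bp.
  have := gt0 _ ap; have := gt0 _ bp; rewrite simple_refl dotBr dotZr.
  have : 0 < a 0 i * dot (rho n) (al i).
    rewrite mulr_gt0 ?dot_simple_gt0 ?rho_strict //.
    move: di; rewrite -pairing_gt0 ?simple_root_mem //.
    by rewrite coroot_simple pairing_delta.
  lia.
exists (rcons s i), j; rewrite word_rcons mulmxA -e -mulmxA reflK ?mulmx1 //.
exact: simple_root_mem.
Qed.

Lemma root_word a : a \in roots D -> exists w i, weyl D w /\ a *m w = al i.
Proof.
have h b : positive_roots D b -> exists w i, weyl D w /\ b *m w = al i.
  move=> /positive_root_word [s [i ->]]; exists (invmx (word s)), i.
  by split; [apply/weylV/weyl_word|rewrite (weylK _ (weyl_word s))].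
move=> aR; case: (positive_neg aR) => [/h //|/h [w [i [Ww e]]]].
exists (w *m s_(al i)), i; split; first by apply: weyl_mul => //; apply: simple_root_mem.
rewrite mulmxA -[a]opprK mulNmx e mulNmx refl_self ?opprK //.
exact: simple_root_mem.
Qed.

Lemma weylP w : weyl D w -> exists s, w = word s.
Proof.
elim=> [|a {}w aR _ [s ->]]; first by exists [::].
wlog ap : a aR / positive_roots D a.
  by case: (positive_neg aR) => [ap|ap]; [|rewrite -reflN //]; apply => //; apply: rootN.
have [t [i ->]] := positive_root_word ap.
exists (s ++ (rev t ++ [:: i] ++ t)); rewrite refl_conj ?simple_root_mem //.
  by rewrite !word_cat /= wordV mulmx1 !mulmxA.
exact: weyl_word.
Qed.

(** The exchange condition: reading the word from right to left, al i
    becomes negative at a letter j just after being equal to al j, and that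
    letter can be removed. *)
Lemma word_deletion s i : ~ positive_roots D (al i *m invmx (word s)) ->
  exists2 t, (size t < size s)%N & word s *m s_(al i) = word t.
Proof.
elim: s => [|j s IH] /=.
  by rewrite invmx1 mulmx1 => /(_ (positive_simple i)).
have jR := simple_root_mem D j; have iR := simple_root_mem D i.
have Ws := weyl_word s; have Wj := weyl_refl jR.
have -> : invmx (s_(al j) *m word s) = invmx (word s) *m s_(al j).
  by rewrite (wordV (j :: s)) rev_cons word_rcons wordV.
rewrite mulmxA; case: (pselect (positive_roots D (al i *m invmx (word s)))) => [bp|/IH [t lt_t e] _].
  move=> bs; exists s => //.
  have e : al i *m invmx (word s) = al j.
    by apply: contrapT => ne; apply: bs; apply: positive_simple_refl.
  have -> : s_(al i) = invmx (word s) *m s_(al j) *m word s.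
    by rewrite -refl_conj // -e (weylVK _ Ws).
  rewrite !mulmxA -(mulmxA (s_(al j))) mulmxV ?(weyl_unit Ws) // mulmx1 reflK //.
  by rewrite mul1mx.
by exists (j :: t) => //=; rewrite -e mulmxA.
Qed.

Lemma pairing_conj x s i : (x *m word s) 0 i = pairing x (al i *m invmx (word s))^v.
Proof.
rewrite -pairing_delta -(coroot_simple D).
rewrite -{1}(weylVK (al i) (weyl_word s)) pairing_weyl //; first exact: weyl_word.
by apply: root_weyl; [apply/weylV/weyl_word|apply: simple_root_mem].
Qed.

(** Induction on the length of a word: either the last letter lowers the
    weight, or it can be removed by the exchange condition. *)
Lemma dominant_sub x w : dominant x -> weyl D w -> dominance D (x *m w) x.
Proof.
move=> xd /weylP [s ->]; have [m] := ubnP (size s); elim: m s => // m IH s.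
case/lastP: s => [|s i]; first by rewrite mulmx1 => _; apply: dominance_refl.
rewrite size_rcons ltnS word_rcons => lt_s.
case: (pselect (positive_roots D (al i *m invmx (word s)))) => [ip|/word_deletion [t lt_t ->]].
  apply: (dominance_trans (y := x *m word s)) (IH _ lt_s).
  rewrite mulmxA simple_refl; set c := (x *m word s) 0 i.
  have c0 : 0 <= c by rewrite /c pairing_conj positive_pairing.
  by have := dominance_simple (x *m word s - c *: al i) i c0; rewrite subrK.
by apply/IH/(leq_trans lt_t)/ltnW.
Qed.

Lemma strictly_dominant_stab x w :
  strictly_dominant x -> weyl D w -> x *m w = x -> w = 1%:M.
Proof.
move=> xd /weylP [s ->]; have [m] := ubnP (size s); elim: m s => // m IH s.
case/lastP: s => [|s i]; first by [].
rewrite size_rcons ltnS word_rcons => lt_s.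
case: (pselect (positive_roots D (al i *m invmx (word s)))) => [ip|/word_deletion [t lt_t ->]].
  rewrite mulmxA simple_refl => e; have := positive_pairing_gt xd ip.
  rewrite -pairing_conj => gt0.
  have := dominance_dot (strictly_dominantW rho_strict) (dominant_sub (strictly_dominantW xd) (weyl_word s)).
  move/eqP: e; rewrite subr_eq => /eqP ->; rewrite dotDr dotZr.
  have := mulr_gt0 gt0 (dot_simple_gt0 (rho_strict i)); entry_lia.
by apply/IH/(leq_trans lt_t)/ltnW.
Qed.

Lemma dominant_unique x w : dominant x -> weyl D w -> dominant (x *m w) -> x *m w = x.
Proof.
move=> xd Ww xwd; apply: dominance_anti (dominant_sub xd Ww) _.
by have := dominant_sub xwd (weylV Ww); rewrite (weylK _ Ww).
Qed.

(** Reflecting a weight in a simple root on which it is negative brings it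
    closer to rho, so every weight reaches the dominant chamber. *)
Lemma raise_ind (P : weight n -> Prop) :
  (forall x, dominant x -> P x) ->
  (forall x i, x 0 i < 0 -> P (x *m s_(al i)) -> P x) -> forall x, P x.
Proof.
move=> Pd Ps x.
have [m] := ubnP `|dot (x - rho n) (x - rho n)|; elim: m x => // m IH x lt_m.
case: (pselect (dominant x)) => [/Pd //|/existsNP [i /negP]].
rewrite -ltNge => xi; apply: (Ps _ i) => //; apply: IH.
have := dot_ge0 D (x - rho n); have := dot_ge0 D (x *m s_(al i) - rho n).
have lt0 : x 0 i * dot (rho n) (al i) < 0.
  by rewrite nmulr_rlt0 // dot_simple_gt0 // rho_strict.
have -> : dot (x *m s_(al i) - rho n) (x *m s_(al i) - rho n) =
    dot (x - rho n) (x - rho n) + 2 * (x 0 i * dot (rho n) (al i)).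
  rewrite !dotBl !dotBr dot_refl ?simple_root_mem //.
  rewrite (dotC _ (x *m _) (rho n)) (dotC _ x (rho n)) simple_refl dotBr dotZr.
  entry_lia.
move: lt0 lt_m; move: (dot (x - _) _) => d; move: (x 0 i * _) => c; lia.
Qed.

Lemma dominant_conj x : exists2 w, weyl D w & dominant (x *m w).
Proof.
elim/raise_ind: x => [x xd|x i _ [w Ww xd]].
  by exists 1%:M; [constructor|rewrite mulmx1].
by exists (s_(al i) *m w); [apply/weylM/Ww/weyl_refl/simple_root_mem|rewrite mulmxA].
Qed.

(** A Weyl group element is determined by its columns, which are the images
    of the simple coroots. *)
Lemma finite_weyl : finite_set (weyl D).
Proof.
pose g (f : {ffun 'I_n -> roots D}) : 'M[int]_n := \matrix_(j, i) (val (f i))^v j 0.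
apply: (@sub_finite_set _ _ (range g)); last first.
  exact/finite_image/finite_finset.
move=> w Ww /=.
have h i : al i *m invmx w \in roots D.
  by apply: root_weyl; [apply: weylV|apply: simple_root_mem].
exists [ffun i => [` h i]%fset] => //; apply/matrixP => j i; rewrite mxE ffunE /=.
have := coroot_weyl Ww (h i); rewrite (weylVK _ Ww) coroot_simple => <-.
rewrite mxE (bigD1 i) //= mxE !eqxx mulr1 big1 ?addr0 // => k ki.
by rewrite mxE (negPf ki) mulr0.
Qed.

End Weyl.

(** * Chains of relations *)

Section Chain.
Variables (T : Type) (R : T -> T -> Prop).
Inductive chain : T -> T -> Prop :=
| chain_refl x : chain x x
| chain_step x y z : R x y -> chain y z -> chain x z.

Lemma chain_trans y x z : chain x y -> chain y z -> chain x z.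
Proof. by elim=> // u v w Ruv _ IH /IH; apply: chain_step. Qed.
Lemma chain1 x y : R x y -> chain x y.
Proof. by move=> h; apply: chain_step h _; apply: chain_refl. Qed.
End Chain.

Lemma chain_map (T U : Type) (R : T -> T -> Prop) (S : U -> U -> Prop) (f : T -> U) :
  (forall x y, R x y -> chain S (f x) (f y)) ->
  forall x y, chain R x y -> chain S (f x) (f y).
Proof.
move=> h x y; elim=> [{}x|{}x {}y z /h + _]; first exact: chain_refl.
exact: chain_trans.
Qed.

(** Removing a point from a predicate lowers its count: the measure of two
    inductions below. *)
Lemma count_lt (T : eqType) (a b : pred T) (s : seq T) x :
  (forall y, y \in s -> a y -> b y) -> x \in s -> b x -> ~~ a x ->
  (count a s < count b s)%N.
Proof.
move=> ab xs bx ax; pose d := [pred y | b y & ~~ a y].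
have d0 : (0 < count d s)%N by rewrite -has_count; apply/hasP; exists x => //=; rewrite bx.
apply: (@leq_trans (count a s + count d s)); first by rewrite -addn1 leq_add2l.
rewrite -count_predUI [X in (_ + X)%N](@eq_count _ _ pred0) ?count_pred0 ?addn0.
  elim: s ab {xs d0} => //= y s IH ab; apply: leq_add; last first.
    by apply: IH => z zs; apply: ab; rewrite in_cons zs orbT.
  by have := ab y (mem_head _ _); case: (a y) (b y) => [] [] //= /(_ isT).
by move=> y /=; case: (a y); rewrite ?andbF.
Qed.

(** * A total order on coweights *)

Section CoweightOrder.
Variable n : nat.
Implicit Types u v : coweight n.

Definition height v : int := \sum_i v i 0.

(** Leading coefficients of these polynomials order the coweights totally
    and compatibly with addition: by height first, then lexicographically. *)
Definition coweight_poly v : {poly int} :=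
  height v *: 'X^n + \sum_(i < n) v i 0 *: 'X^i.

Definition cpos v : Prop := 0 < lead_coef (coweight_poly v).

Lemma height_rho v : pairing (rho n) v = height v.
Proof. by rewrite pairing_sum; apply: eq_bigr => i _; rewrite rho_coord mul1r. Qed.

Lemma coweight_polyD u v : coweight_poly (u + v) = coweight_poly u + coweight_poly v.
Proof.
rewrite /coweight_poly -!height_rho pairingDr scalerDl [RHS]addrACA; congr (_ + _).
by rewrite -big_split; apply: eq_bigr => i _; rewrite mxE scalerDl.
Qed.

Lemma coweight_polyZ c v : coweight_poly (c *: v) = c *: coweight_poly v.
Proof.
rewrite /coweight_poly -!height_rho pairingZr scalerDr scalerA scaler_sumr.
by congr (_ + _); apply: eq_bigr => i _; rewrite mxE scalerA.
Qed.

Lemma coweight_poly_eq0 v : coweight_poly v = 0 -> v = 0.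
Proof.
move=> /polyP e; apply/colP => i; have := e i.
rewrite coef0 mxE coefD coefZ coefXn ltn_eqF // mulr0 add0r coef_sum (bigD1 i) //=.
rewrite coefZ coefXn eqxx mulr1 big1 ?addr0 // => j ji.
by rewrite coefZ coefXn -val_eqE eq_sym in ji *; rewrite (negPf ji) mulr0.
Qed.

Lemma cposD u v : cpos u -> cpos v -> cpos (u + v).
Proof.
rewrite /cpos coweight_polyD; move: (coweight_poly u) (coweight_poly v) => f g f0 g0.
case: (ltngtP (size f) (size g)) => e.
- by rewrite lead_coefDr.
- by rewrite lead_coefDl.
have h : 0 < (f + g)`_(size f).-1 by rewrite coefD {2}e addr_gt0.
suff -> : lead_coef (f + g) = (f + g)`_(size f).-1 by [].
rewrite /lead_coef; congr (_`_ _.-1); apply/eqP; rewrite eqn_leq.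
have sf : (0 < size f)%N by rewrite size_poly_gt0 -lead_coef_eq0 gt_eqF.
have /leq_trans -> := size_polyD f g; last by rewrite e maxnn.
rewrite -{1}(prednK sf); apply: contraTT h; rewrite -leqNgt => /leq_sizeP -> //.
Qed.

Lemma cposZ c v : 0 < c -> cpos (c *: v) <-> cpos v.
Proof. by move=> c0; rewrite /cpos coweight_polyZ lead_coefZ pmulr_rgt0. Qed.

Lemma cposN v : cpos v -> ~ cpos (- v).
Proof.
rewrite /cpos -scaleN1r coweight_polyZ lead_coefZ mulN1r oppr_gt0 => v0.
by apply/negP; rewrite -leNgt ltW.
Qed.

Lemma cpos_total v : [\/ v = 0, cpos v | cpos (- v)].
Proof.
rewrite /cpos -scaleN1r coweight_polyZ lead_coefZ mulN1r.
case: (ltgtP 0 (lead_coef (coweight_poly v))) => [||/esym/eqP].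
- by constructor 2.
- by rewrite oppr_gt0; constructor 3.
by rewrite lead_coef_eq0 => /eqP/coweight_poly_eq0; constructor 1.
Qed.

Lemma cpos_height v : 0 < height v -> cpos v.
Proof.
move=> h; rewrite /cpos /coweight_poly.
have lt : (size (\sum_(i < n) v i 0 *: 'X^i : {poly int})%R <
    size (height v *: 'X^n : {poly int})%R)%N.
  rewrite size_scale ?gt_eqF // size_polyXn ltnS; apply/leq_sizeP => j nj.
  rewrite coef_sum big1 // => i _; rewrite coefZ coefXn gtn_eqF ?mulr0 //.
  exact: leq_trans nj.
by rewrite (lead_coefDl lt) lead_coefZ lead_coefXn mulr1.
Qed.

Lemma height_ge0 v : cpos v -> 0 <= height v.
Proof.
move/cposN => h; rewrite leNgt; apply/negP => lt0; apply: h; apply: cpos_height.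
by rewrite -height_rho pairingNr height_rho oppr_gt0.
Qed.

End CoweightOrder.

(** * Moving the base point of the linkage order *)

Section Linkage.
Variables (n : nat) (D : root_datum n) (p : nat).
Implicit Types (x y z : weight n) (a b : weight n) (j k : int).
Local Notation "a '^v'" := (coroot D a) (at level 2, format "a '^v'").
Local Notation s_ a := (root_reflection D a).
Local Notation al := (simple_root D).
Local Notation dot := (dot D).
Local Notation pz := (p%:Z).

Definition affine_refl b k x : weight n := x - (pairing x b^v - k * pz) *: b.

(** Reflects a weight lying on the negative side of the hyperplane <x, b^v>
    = k p to the other side; B selects the oriented hyperplanes that may be
    crossed. A set B of the form used here describes a base point: B b k
    says that it lies on the negative side as well. *)
Definition crossing (B : weight n -> int -> Prop) x y : Prop := exists b k,
  [/\ b \in roots D, B b k, pairing x b^v <= k * pz & y = affine_refl b k x].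

(** Base point close to 0, with every Weyl group move allowed: up to the
    action of the Weyl group, the start of a step lies on the segment from
    its end to a reflection of that end. *)
Definition linked : weight n -> weight n -> Prop := chain (crossing (fun _ k => 0 <= k)).

Lemma affine_reflE b k x : affine_refl b k x = x *m s_ b + (k * pz) *: b.
Proof. by rewrite refl_mul /affine_refl scalerBl opprB addrCA addrC. Qed.

Lemma affine_reflN b k x : b \in roots D -> affine_refl (- b) (- k) x = affine_refl b k x.
Proof. by move=> bR; rewrite !affine_reflE reflN // mulNr scaleNr scalerN opprK. Qed.

Lemma affine_reflK b k : b \in roots D -> involutive (affine_refl b k).
Proof.
move=> bR x; rewrite !affine_reflE mulmxDl -mulmxA reflK // mulmx1 -scalemxAl.
by rewrite refl_self // scalerN addrNK.
Qed.

Lemma coroot_refl a b : a \in roots D -> b \in roots D ->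
  (b *m s_ a)^v = b^v - pairing a b^v *: a^v.
Proof.
move=> aR bR; have := coroot_weyl (weyl_refl aR) bR => /(congr1 (mulmx (s_ a))).
by rewrite mulmxA reflK // mul1mx => ->; rewrite reflection_mulr.
Qed.

(** Distinct hyperplanes of the family are not met at the same time, because
    the root datum is reduced. *)
Lemma proportional_roots a b j k : positive_roots D a -> positive_roots D b ->
  0 < k -> k *: a^v = j *: b^v -> a = b /\ k = j.
Proof.
move=> ap bp k0 e; have aR := positive_root ap; have bR := positive_root bp.
have e' x : k * dot b b * dot x a = j * dot a a * dot x b.
  have := congr1 (pairing x) e; rewrite !pairingZr => ex.
  apply: (@mulfI _ (2 : int)) => //.
  transitivity (k * pairing x a^v * (dot a a * dot b b)).
    have -> : 2 * (k * dot b b * dot x a) = k * dot b b * (2 * dot x a) by ring.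
    by rewrite -pairing_dot //; ring.
  have -> : 2 * (j * dot a a * dot x b) = j * dot a a * (2 * dot x b) by ring.
  by rewrite -pairing_dot // ex; ring.
have eab : (k * dot b b) *: a = (j * dot a a) *: b.
  apply/eqP; rewrite -subr_eq0; apply/eqP/(@dot_eq0 _ D).
  by rewrite dotBr !dotZr e' subrr.
have nz : k * dot b b != 0 by rewrite gt_eqF // mulr_gt0 // dot_root_gt0.
have [eb|eb] := roots_reduced aR bR nz eab; last first.
  by move: bp; rewrite eb => /(positive_asym ap).
split; first by rewrite eb.
have := congr1 (pairing a) e; rewrite eb !pairingZr pairing_coroot //; lia.
Qed.

(** (b, j) stands for the hyperplane <x, b^v> = - j p. When b is positive
    and j > 0, the base point -t d, for d infinitesimally close to the sum
    of fundamental weights and t decreasing, crosses it at t = j p / <d,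
    b^v>, so the order in which hyperplanes are crossed is read off the
    order on coweights. *)
Definition wall : Type := (weight n * int)%type.
Implicit Types h : wall.
Definition is_wall h : Prop := positive_roots D h.1 /\ 0 < h.2.
Definition nearer h' h : Prop := cpos (h.2 *: h'.1^v - h'.2 *: h.1^v).
(** When the base point is on the wall h, it lies strictly on the negative
    side of <x, b^v> = k p. *)
Definition beyond h b k : Prop := cpos (k *: h.1^v + h.2 *: b^v).
(** The base point is about to cross h, respectively has just crossed it:
    only the orientation of h itself changes. *)
Definition before h b k : Prop := beyond h b k \/ (b = h.1 /\ k = - h.2).
Definition after h b k : Prop := beyond h b k \/ (b = - h.1 /\ k = h.2).

(** The reflection in h fixes the base point on h, so it preserves the
    relation to that base point. *)
Lemma crossing_conj h x y : is_wall h -> crossing (beyond h) x y ->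
  crossing (beyond h) (affine_refl h.1 (- h.2) x) (affine_refl h.1 (- h.2) y).
Proof.
case: h => a j [/= ap j0] [b [k [bR Bk xk ->]]]; have aR := positive_root ap.
have ab : pairing a (b *m s_ a)^v = - pairing a b^v.
  by rewrite coroot_refl // pairingBr pairingZr pairing_coroot //; lia.
have e x' : pairing (affine_refl a (- j) x') (b *m s_ a)^v =
    pairing x' b^v + j * pairing a b^v * pz.
  rewrite affine_reflE pairingDl pairingZl ab pairing_weyl //; last exact: weyl_refl.
  by lia.
exists (b *m s_ a), (k + j * pairing a b^v); split.
- exact: reflection_root.
- move: Bk; rewrite /beyond /= coroot_refl // scalerBr scalerA scalerDl.
  by rewrite addrACA subrr addr0.
- by rewrite e; lia.
have def b' k' x' : affine_refl b' k' x' = x' - (pairing x' b'^v - k' * pz) *: b' by [].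
rewrite [RHS]def e (def b) !affine_reflE mulmxBl -scalemxAl.
rewrite addrAC; congr (_ - _ *: _); lia.
Qed.

(** Folds the space along h onto the side of h that contains the dominant
    chamber. *)
Definition fold h x :=
  if - h.2 * pz <= pairing x h.1^v then x else affine_refl h.1 (- h.2) x.

(** A step across h itself collapses, and a step that stays on one side of h
    is kept or reflected. A step between the two sides is replaced by two
    steps; the additional one is the crossing of h, which the move of the
    base point made legal in the outward direction. *)
Lemma crossing_fold h x y : is_wall h -> crossing (before h) x y ->
  chain (crossing (after h)) (fold h x) (fold h y).
Proof.
move=> hw; have [hp h0] := hw; have hR := positive_root hp.
pose s := affine_refl h.1 (- h.2).
have s_on z : pairing z h.1^v = - h.2 * pz -> s z = z.
  by move=> e; rewrite /s /affine_refl e subrr scale0r subr0.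
have s_near z : pairing (s z) h.1^v = - 2 * h.2 * pz - pairing z h.1^v.
  rewrite /s /affine_refl pairingBl pairingZl pairing_coroot //; lia.
have sub u v : crossing (beyond h) u v -> chain (crossing (after h)) u v.
  by case=> b [k [bR Bk uk e]]; apply/chain1; exists b, k; split=> //; left.
have cross z : - h.2 * pz <= pairing z h.1^v -> chain (crossing (after h)) z (s z).
  move=> zn; apply/chain1; exists (- h.1), h.2; split.
  - exact: rootN.
  - by right.
  - by rewrite corootN // pairingNr; lia.
  - by rewrite -[h.2 in RHS]opprK affine_reflN.
move=> [b [k [bR [Bk|[eb ek]] xk ey]]]; last first.
  rewrite {}eb {}ek in bR xk ey *; rewrite /fold; move: (s_near x).
  rewrite -/s in ey *; rewrite -ey => e; case: leP => [xn|_].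
    have ex : y = x by rewrite ey s_on //; lia.
    by rewrite ex xn; apply: chain_refl.
  have -> : - h.2 * pz <= pairing y h.1^v by lia.
  by rewrite ey; apply: chain_refl.
have C : crossing (beyond h) x y by exists b, k.
have Cs : crossing (beyond h) (s x) (s y) by apply: crossing_conj.
rewrite /fold -/s; case: leP => xn; case: leP => yn.
- exact: sub.
- apply: chain_trans (sub _ _ Cs); exact: cross.
- apply: chain_trans (sub _ _ C); rewrite -{2}(affine_reflK (- h.2) hR x).
  by apply: cross; rewrite s_near; lia.
- exact: sub.
Qed.

Lemma nearer_trans h1 h2 h3 : is_wall h1 -> is_wall h2 -> is_wall h3 ->
  nearer h1 h2 -> nearer h2 h3 -> nearer h1 h3.
Proof.
case: h1 h2 h3 => [a i] [b j] [c k] [/= _ i0] [/= _ j0] [/= _ k0].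
rewrite /nearer /= => n12 n23; rewrite -(cposZ _ j0).
have -> : j *: (k *: a^v - i *: c^v) =
    k *: (j *: a^v - i *: b^v) + i *: (k *: b^v - j *: c^v).
  by apply/colP => r; rewrite !mxE; ring.
by apply: cposD; rewrite cposZ.
Qed.

Lemma nearer_irr h : ~ nearer h h.
Proof. by rewrite /nearer subrr => c0; have := cposN c0; rewrite oppr0. Qed.

Lemma heightD u v : @height n (u + v) = height u + height v.
Proof. by rewrite -!height_rho pairingDr. Qed.
Lemma heightZ k v : @height n (k *: v) = k * height v.
Proof. by rewrite -!height_rho pairingZr. Qed.
Lemma heightN v : @height n (- v) = - height v.
Proof. by rewrite -!height_rho pairingNr. Qed.
Lemma height_gt0 b : positive_roots D b -> 0 < height b^v.
Proof. by move=> bp; rewrite -height_rho; apply: positive_pairing_gt (@rho_strict n) bp. Qed.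

Lemma beyond_lt0 h b k : is_wall h -> b \in roots D -> beyond h b k -> k < 0 ->
  is_wall (b, - k) /\ nearer (b, - k) h.
Proof.
move=> [hp h0] bR bey k0; case: (positive_neg bR) => bp.
  split; first by split => //=; lia.
  by rewrite /nearer /= scaleNr opprK addrC.
have /height_ge0 := bey; rewrite heightD !heightZ.
have := height_gt0 bp; rewrite corootN // heightN => h1; have h2 := height_gt0 hp.
nia.
Qed.

(** With no wall left to cross, the base point lies on the negative side
    only of hyperplanes with k >= 0. *)
Lemma after_nonneg h b k : is_wall h -> b \in roots D ->
  (forall h', is_wall h' -> ~ nearer h' h) -> after h b k -> 0 <= k.
Proof.
move=> hw bR no [bey|[_ ->]]; last by case: hw => _ /ltW.
rewrite leNgt; apply/negP => /(beyond_lt0 hw bR bey) [w1 w2]; exact: no w1 w2.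
Qed.

(** Nothing changes while the base point moves from a wall to the next one. *)
Lemma after_before h h' b k : is_wall h -> is_wall h' -> b \in roots D ->
  nearer h' h -> (forall h'', is_wall h'' -> nearer h'' h -> ~ nearer h' h'') ->
  after h b k -> before h' b k.
Proof.
move=> hw hw' bR nh max [bey|[-> ->]]; last first.
  by left; rewrite /beyond corootN ?scalerN //; case: hw => [[]].
have [[hp h0] [hp' h0']] := (hw, hw').
case: (ltrP k 0) => k0; last first.
  left; case: (positive_neg bR) => bp.
    apply: cpos_height; rewrite heightD !heightZ.
    by have := height_gt0 bp; have := height_gt0 hp'; nia.
  have hb := height_gt0 bp; rewrite corootN // heightN in hb.
  have {}k0 : 0 < k.
    rewrite lt_def k0 andbT; apply/eqP => e; move/height_ge0: bey.
    by rewrite e scale0r add0r heightZ; nia.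
  rewrite /beyond -(cposZ _ h0).
  have -> : h.2 *: (k *: h'.1^v + h'.2 *: b^v) =
    k *: (h.2 *: h'.1^v - h'.2 *: h.1^v) + h'.2 *: (k *: h.1^v + h.2 *: b^v).
    by apply/colP => r; rewrite !mxE; ring.
  by apply: cposD; rewrite cposZ.
have [bw nb] := beyond_lt0 hw bR bey k0.
case: (cpos_total (k *: h'.1^v + h'.2 *: b^v)) => [e||neg]; [right|by left|].
  have k0' : 0 < - k by lia.
  have e' : - k *: h'.1^v = h'.2 *: b^v.
    by apply/eqP; rewrite -subr_eq0 scaleNr -opprD e oppr0.
  by have [-> <-] := proportional_roots hp' bw.1 k0' e'; rewrite opprK.
by case: (max _ bw nb); move: neg; rewrite /nearer /= opprD scaleNr.
Qed.

(** Dominant weights are on the near side of every wall, so folding fixes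
    both ends of the chain. Induction on the number of walls still to be
    crossed, which is finite since they have bounded height. *)
Lemma before_linked h x y : is_wall h -> dominant x -> dominant y ->
  chain (crossing (before h)) x y -> linked x y.
Proof.
move=> hw0 xd yd.
pose J := `|(h.2 * \sum_(b <- roots D) `|height b^v|)%R|%N.
pose S : seq wall := [seq (b, Posz i) | b <- roots D, i <- iota 1 J].
pose near h' h : bool := `[< is_wall h' /\ nearer h' h >].
pose cnt h := count (near^~ h) S.
have inS h' : is_wall h' -> nearer h' h -> h' \in S.
  case: h' => a j [/= ap j0] nh; apply/allpairsP; exists (a, `|j|%N); split => /=.
  - exact: positive_root.
  - rewrite mem_iota; apply/andP; split; first lia.
    have := height_ge0 nh; rewrite heightD heightN !heightZ /=.
    have h1 : 0 < height (h.1)^v by apply: height_gt0; case: hw0.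
    have h2 : height a^v <= \sum_(b <- roots D) `|height b^v|.
      rewrite (big_rem a) ?positive_root //=.
      by rewrite (le_trans (ler_norm _)) // lerDl; apply: sumr_ge0.
    have := hw0.2; rewrite /J; set s := \sum_(b <- _) _ in h2 *; nia.
  - by congr (_, _); lia.
clearbody S; clear J; have [N] := ubnP (cnt h).
elim: N h hw0 inS => // N IH h' hw inS'; rewrite ltnS => lt_N.
move=> /(chain_map (f := fold h') (fun u v => @crossing_fold h' u v hw)).
have fx z : dominant z -> fold h' z = z.
  move=> zd; rewrite /fold mulNr; have := positive_pairing zd hw.1.
  have ge0 : 0 <= h'.2 * pz by rewrite mulr_ge0 // ltW // hw.2.
  by move=> px; have -> : - (h'.2 * pz) <= pairing z h'.1^v by lia.
rewrite !fx // => C.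
case: (pselect (exists h'', is_wall h'' /\ nearer h'' h')) => [ex|no]; last first.
  apply: (chain_map (f := id) _ C) => u v [b [k [bR Bk uk e]]].
  apply: chain1; exists b, k; split => //; apply: after_nonneg Bk => //.
  by move=> h'' w1 w2; apply: no; exists h''.
pose P m := has (fun h'' => near h'' h' && (cnt h'' == m)) S.
have exP : exists m, P m.
  case: ex => h'' [w1 w2]; exists (cnt h''); apply/hasP; exists h''; first exact: inS'.
  by rewrite eqxx andbT; apply/asboolP.
have ubP m : P m -> (m <= size S)%N.
  by move=> /hasP [h'' _ /andP[_ /eqP <-]]; apply: count_size.
(* the next wall is the one with the most walls left to cross after it *)
case: (ex_maxnP exP ubP) => m /hasP [h'' h''S /andP[/asboolP [hw'' nh] /eqP em]] max.
have cnt_lt h1 h2 : is_wall h1 -> is_wall h2 -> h1 \in S -> nearer h1 h2 ->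
    (cnt h1 < cnt h2)%N.
  move=> w1 w2 h1S n12; apply: (count_lt (x := h1)) => //.
  - move=> h3 _ /asboolP [w3 n31]; apply/asboolP; split=> //.
    exact: nearer_trans n31 n12.
  - exact/asboolP.
  - by apply/asboolP => -[_ /nearer_irr].
apply: (IH h'') => //.
- by move=> h3 w3 n3; apply: inS' => //; apply: (nearer_trans w3 hw'').
- exact: leq_trans (cnt_lt _ _ hw'' hw h''S nh) lt_N.
apply: (chain_map (f := id) _ C) => u v [b [k [bR Bk uk e]]].
apply: chain1; exists b, k; split => //; apply: after_before Bk => // h3 w3 n3 n''.
have h3S : h3 \in S by apply: inS'.
have := cnt_lt _ _ hw'' w3 h''S n''; rewrite ltnNge em => /negP; apply; apply: max.
by apply/hasP; exists h3 => //; rewrite eqxx andbT; apply/asboolP.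
Qed.

End Linkage.

(** * Linkage and the up-arrow order on dominant weights *)

Section Psi.
Variables (n : nat) (D : root_datum n) (p : nat).
Implicit Types (x y z : weight n) (a b : weight n) (j k : int).
Local Notation "a '^v'" := (coroot D a) (at level 2, format "a '^v'").
Local Notation s_ a := (root_reflection D a).
Local Notation al := (simple_root D).
Local Notation dot := (dot D).
Local Notation pz := (p%:Z).
Local Notation linked := (linked D p).
Local Notation up x y := (uparrow D p (x - rho n) (y - rho n)).

Lemma crossing_weyl w x y : weyl D w -> crossing D p (fun _ k => 0 <= k) x y ->
  crossing D p (fun _ k => 0 <= k) (x *m w) (y *m w).
Proof.
move=> Ww [b [k [bR k0 xk ->]]]; exists (b *m w), k; split => //.
- exact: root_weyl.
- by rewrite pairing_weyl.
by rewrite /affine_refl pairing_weyl // mulmxBl -scalemxAl.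
Qed.

Lemma linked_weyl x w : weyl D w -> linked x (x *m w).
Proof.
elim=> [|a {}w aR _ IH]; first by rewrite mulmx1; apply: chain_refl.
apply: chain_trans IH _; apply: chain1; rewrite mulmxA; move: (x *m w) => z.
case: (lerP (pairing z a^v) 0) => az; [exists a, 0|exists (- a), 0]; split => //.
- by rewrite affine_reflE mul0r scale0r addr0.
- exact: rootN.
- by rewrite corootN // pairingNr; lia.
by rewrite affine_reflE mul0r scale0r addr0 reflN.
Qed.

Lemma linked_weyl2 x y w w' : weyl D w -> weyl D w' -> linked x y ->
  linked (x *m w) (y *m w').
Proof.
move=> Ww Ww' l; rewrite -{1}(weylK x Ww); apply: chain_trans (linked_weyl _ Ww').
by apply: chain_trans l; have := linked_weyl (x *m w) (weylV Ww); rewrite !(weylK _ Ww).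
Qed.

Hypothesis p_gt0 : (0 < p)%N.

Lemma up_trans y x z : up x y -> up y z -> up x z.
Proof.
move: (x - _) (y - _) (z - _) => u v t; elim=> // u' v' a k ap d _ IH /IH.
exact: uparrow_step.
Qed.

Lemma up_cross x a k : positive_roots D a -> pairing x a^v <= k * pz ->
  up x (affine_refl D p a k x).
Proof.
move=> ap xk.
have e : affine_dot D p a k (x - rho n) = affine_refl D p a k x - rho n.
  by rewrite /affine_dot /affine_refl subrK addrAC.
refine (@uparrow_step n D p _ _ a k ap _ _); rewrite e; last exact: uparrow_refl.
rewrite -dominanceDr dominance_sub_ge0 /affine_refl addrAC subrr add0r -scaleNr.
by apply: dominanceZ; [lia|case: ap].
Qed.

Lemma up_dominance x y : up x y -> dominance D x y.
Proof.
rewrite (dominanceDr D (- rho n)); move: (x - _) (y - _) => u v.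
by elim=> [z|u' v' a k _ d _ IH]; [apply: dominance_refl|apply: dominance_trans d IH].
Qed.

Lemma up_raise x : exists w, [/\ weyl D w, dominant (x *m w) & up x (x *m w)].
Proof.
elim/(@raise_ind n D): x => [x xd|x i xi [w [Ww xd xu]]].
  by exists 1%:M; rewrite mulmx1; split => //; constructor.
exists (s_(al i) *m w); rewrite mulmxA; split => //.
  by apply/weylM/Ww/weyl_refl/simple_root_mem.
apply: up_trans xu; have := up_cross (x := x) (k := 0) (positive_simple D i).
rewrite affine_reflE mul0r scale0r addr0; apply.
by rewrite coroot_simple pairing_delta ltW.
Qed.

(** Translations by positive multiples of p a are products of two upward
    reflections. *)
Lemma up_translate x a k : positive_roots D a -> 0 <= k -> up x (x + (k * pz) *: a).
Proof.
move=> ap; rewrite le_eqVlt => /predU1P[<-|k0].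
  by rewrite mul0r scale0r addr0; apply: uparrow_refl.
have aR := positive_root ap.
(* the first wall above x, then its translate by k *)
pose j := (pairing x a^v %/ pz)%Z + 1.
have [j1 j2] : pairing x a^v <= j * pz /\ j * pz - pairing x a^v <= pz.
  rewrite /j; have := divz_eq (pairing x a^v) pz.
  have : (0 <= pairing x a^v %% pz)%Z by rewrite modz_ge0 //; lia.
  have : (pairing x a^v %% pz)%Z < pz by rewrite ltz_pmod //; lia.
  lia.
apply: (up_trans (up_cross ap j1)).
have e : pairing (affine_refl D p a j x) a^v = 2 * j * pz - pairing x a^v.
  by rewrite /affine_refl pairingBl pairingZl pairing_coroot //; lia.
have e2 : affine_refl D p a (j + k) (affine_refl D p a j x) = x + (k * pz) *: a.
  rewrite {1}/affine_refl e /affine_refl -addrA -opprD -scalerDl -scaleNr.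
  by congr (_ + _ *: _); lia.
by rewrite -e2; apply: up_cross => //; rewrite e; nia.
Qed.

(** If the root of the step is negative, the step is a translation by a
    positive multiple of the opposite root, up to a Weyl group element. *)
Lemma crossing_up x y : dominant x -> crossing D p (fun _ k => 0 <= k) x y ->
  exists w, [/\ weyl D w, dominant (y *m w) & up x (y *m w)].
Proof.
move=> xd [b [k [bR k0 xk ->]]]; case: (positive_neg bR) => bp.
  have [w [Ww d u]] := up_raise (affine_refl D p b k x).
  by exists w; split => //; apply: up_trans u; apply: up_cross.
have [w [Ww d u]] := up_raise (x + (k * pz) *: (- b)).
exists (s_ b *m w); rewrite mulmxA affine_reflE mulmxDl -mulmxA reflK // mulmx1.
rewrite -scalemxAl refl_self //; split => //.
  by apply: weylM => //; apply: weyl_refl.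
by apply: up_trans u; apply: up_translate.
Qed.

Lemma dominant_orbit_unique x w w' : weyl D w -> weyl D w' ->
  dominant (x *m w) -> dominant (x *m w') -> x *m w = x *m w'.
Proof.
move=> Ww Ww' d d'.
have e : x *m w' = x *m w *m (invmx w *m w') by rewrite mulmxA (weylK _ Ww).
rewrite e; apply/esym/(@dominant_unique n D); rewrite -?e //.
by apply: weylM => //; apply: weylV.
Qed.

Lemma linked_up x y : dominant x -> dominant y -> linked x y -> up x y.
Proof.
move=> xd yd l.
have weyl1 : weyl D (1%:M : 'M_n) by constructor.
suff h w w' : weyl D w -> weyl D w' -> dominant (x *m w) -> dominant (y *m w') ->
    up (x *m w) (y *m w').
  by have := h _ _ weyl1 weyl1; rewrite !mulmx1; apply.
elim: l w w' {xd yd} => [z|u v z uv _ IH] w w' Ww Ww' d d'.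
  by rewrite (dominant_orbit_unique Ww Ww' d d'); apply: uparrow_refl.
have [w2 [Ww2 d2 u2]] := crossing_up d (crossing_weyl Ww uv).
apply: up_trans u2 _; rewrite -mulmxA in d2 *.
by apply: IH => //; apply: weylM.
Qed.

(** Steps of the up-arrow order are crossings for a base point sufficiently
    far in the antidominant chamber. *)
Lemma up_chain x y a : positive_roots D a -> up x y ->
  exists J, forall j, J <= j -> chain (crossing D p (before D (a, j))) x y.
Proof.
move=> ap; rewrite -{2}[x](subrK (rho n)) -{2}[y](subrK (rho n)).
move: (x - rho n) (y - rho n) => u v; elim=> [z|{}u {}v b k bp d _ [J hJ]].
  by exists 0 => j _; apply: chain_refl.
(* far enough for (b, k) to be beyond the wall *)
exists (`|J| + `|k| * height a^v + 1) => j Jj.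
have [ha hb] := (height_gt0 ap, height_gt0 bp).
have kh : 0 <= `|k| * height a^v by rewrite mulr_ge0 // ltW.
apply: chain_step (hJ j _); last by lia.
exists b, k; split.
- exact: positive_root.
- left; apply: cpos_height; rewrite heightD !heightZ /=.
  have : - k * height a^v <= `|k| * height a^v by rewrite ler_wpM2r ?(ltW ha) //; lia.
  have : j * 1 <= j * height b^v by rewrite ler_wpM2l //; lia.
  lia.
- move: d => /(dominance_sub_ge0 _).
  rewrite /affine_dot addrAC subrr add0r => /(dominance_dot (strictly_dominantW (@rho_strict n))).
  rewrite dot0r dotNr dotZr oppr_ge0.
  have rb : 0 < dot (rho n) b.
    by rewrite -pairing_gt0 ?positive_root // height_rho.
  by rewrite pmulr_lle0 // subr_le0.
by rewrite /affine_dot /affine_refl addrAC.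
Qed.

(** The converse of linked_up is the delicate direction: an upward chain may
    leave the dominant chamber through weights whose dominant conjugates are
    not below y. *)
Lemma up_linked x y : dominant x -> dominant y -> up x y -> linked x y.
Proof.
move=> xd yd u; have [a0 a0R] := roots_neq0 D.
have [a ap] : exists a, positive_roots D a.
  by case: (positive_neg a0R); [exists a0|exists (- a0)].
have [J hJ] := up_chain ap u.
apply: (before_linked (h := (a, `|J| + 1))) => //; last by apply: hJ; lia.
by split => //=; lia.
Qed.

Lemma PsiP la x : dominant la -> Psi D p la x <-> dominant x /\ linked x la.
Proof.
by move=> ld; split=> -[xd l]; split => //; [apply: up_linked|apply: linked_up].
Qed.

Lemma Psi_dominance la x : Psi D p la x -> dominance D x la.
Proof. by case=> _ /up_dominance. Qed.

End Psi.

(** * The highest short root and bounds on pairings *)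

Section Bounds.
Variables (n : nat) (D : root_datum n).
Implicit Types (x y z e t : weight n) (a b : weight n).
Local Notation "a '^v'" := (coroot D a) (at level 2, format "a '^v'").
Local Notation s_ a := (root_reflection D a).
Local Notation al := (simple_root D).
Local Notation dot := (dot D).

(** The hypothesis forces e u^-1 to be dominant, hence equal to e. *)
Lemma dominant_stab e t u : dominant e -> dominant t -> weyl D u ->
  (forall b, b \in roots D -> 0 < pairing e b^v -> 0 < pairing (t *m u) b^v) ->
  e *m u = e.
Proof.
move=> ed td Wu h; have WV := weylV Wu.
suff d : dominant (e *m invmx u).
  by rewrite -{1}(dominant_unique ed WV d) (weylVK _ Wu).
move=> i; rewrite leNgt; apply/negP.
have iR := simple_root_mem D i; have uR := root_weyl Wu iR.
have pe x : pairing (x *m u) (al i *m u)^v = x 0 i.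
  by rewrite pairing_weyl // coroot_simple pairing_delta.
rewrite -pe (weylVK _ Wu) => lt0.
have := h _ (rootN uR); rewrite corootN // !pairingNr pe => /(_ _)/wrap[]; first by lia.
by have := td i; entry_lia.
Qed.

Lemma positive_coord b i : positive_roots D b -> 0 <= b^v i 0.
Proof.
rewrite -pairing_fundamental; apply: positive_pairing => j.
by rewrite mxE; case: eqP.
Qed.

Lemma pairing_gt0_coord e b : dominant e -> b \in roots D -> 0 < pairing e b^v ->
  exists i, [/\ positive_roots D b, 0 < e 0 i & 0 < b^v i 0].
Proof.
move=> ed bR eb; have bp : positive_roots D b.
  case: (positive_neg bR) => // /(positive_pairing ed).
  by rewrite corootN // pairingNr oppr_ge0 leNgt eb.
have [i /andP[ei bi]] : exists i, (0 < e 0 i) && (0 < b^v i 0).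
  apply/existsP; apply: contraLR eb; rewrite negb_exists => /forallP h.
  rewrite -leNgt pairing_sum sumr_le0 // => i _; have := h i; have := ed i.
  have := positive_coord i bp; rewrite negb_and -!leNgt => b0 e0 /orP[e1|b1].
    by have -> : e 0 i = 0 by [apply/eqP; rewrite eq_le e1 e0]; rewrite mul0r.
  by have -> : b^v i 0 = 0 by [apply/eqP; rewrite eq_le b1 b0]; rewrite mulr0.
by exists i.
Qed.

Lemma pairing_ge_coord x b i (m : int) : dominant x -> positive_roots D b ->
  0 < b^v i 0 -> 0 <= m -> m <= x 0 i -> m <= pairing x b^v.
Proof.
move=> xd bp bi m0 mx; rewrite pairing_sum (bigD1 i) //=.
rewrite -[m]addr0 lerD //; last first.
  by apply: sumr_ge0 => j _; rewrite mulr_ge0 ?positive_coord // xd.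
by rewrite (le_trans mx) // ler_peMr ?xd //; move: bi; move: (b^v i 0) => k; lia.
Qed.

Section HighestShort.
Variable a0 : weight n.
Hypothesis a0_highest : highest_short_root D a0.

Lemma root_normsqE a : root_normsq D a = dot a a.
Proof. by apply: eq_bigr => b _; rewrite expr2. Qed.

Lemma highest_root : a0 \in roots D.
Proof. by case: a0_highest => [[]]. Qed.

Lemma highest_norm b : b \in roots D -> dot a0 a0 <= dot b b.
Proof. by rewrite -!root_normsqE; case: a0_highest => [[_ h] _]; apply: h. Qed.

Lemma highest_dominant : dominant a0.
Proof.
move=> i; rewrite leNgt; apply/negP => lt0; have iR := simple_root_mem D i.
have sb : short_root D (a0 *m s_(al i)).
  split=> [|b bR]; first by apply: reflection_root => //; apply: highest_root.
  by rewrite !root_normsqE dot_refl // highest_norm.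
have := dominance_dot (strictly_dominantW (@rho_strict n)) (a0_highest.2 _ sb).
rewrite simple_refl dotBr dotZr.
have := dot_simple_gt0 D (rho_strict i); rewrite -(nmulr_rlt0 _ lt0) => l1; entry_lia.
Qed.

(** The roots that are not orthogonal to the whole orbit of a0 are closed in
    the sense of irreducibility, so they are all the roots; and a0 is the
    largest weight of its orbit. *)
Lemma highest_dot_gt0 b : b \in roots D -> dominant b -> 0 < dot b a0.
Proof.
move=> bR bd.
pose A := [fset c in roots D | `[< exists2 w, weyl D w & dot c (a0 *m w) != 0 >]]%fset.
have AP c : c \in A <-> c \in roots D /\ exists2 w, weyl D w & dot c (a0 *m w) != 0.
  by rewrite !inE /=; split => [/andP[? /asboolP]|[-> h]] //; apply/asboolP.
have orth c d : c \in A -> d \in roots D -> d \notin A -> dot c d = 0.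
  move=> /AP [cR [w Ww cw]] dR /negP dA.
  have od u : weyl D u -> dot d (a0 *m u) = 0.
    move=> Wu; apply: contrapT => /eqP h; apply: dA; apply/AP; split=> //.
    by exists u.
  have := od _ (weyl_mul cR Ww); rewrite mulmxA refl_mul dotBr dotZr od // sub0r.
  move/eqP; rewrite oppr_eq0 mulf_eq0 => /orP [/eqP h|/eqP]; last by rewrite dotC.
  have := pairing_dot (a0 *m w) cR; rewrite h mul0r => /esym/eqP.
  by rewrite mulf_eq0 /= dotC (negPf cw).
have orthp c d : c \in A -> d \in roots D -> d \notin A ->
    pairing c d^v = 0 /\ pairing d c^v = 0.
  move=> cA dR dA; have cR : c \in roots D by case/AP: cA.
  have cd := orth _ _ cA dR dA.
  split; [apply: (mulIf (lt0r_neq0 (dot_root_gt0 dR)))|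
          apply: (mulIf (lt0r_neq0 (dot_root_gt0 cR)))].
    by rewrite pairing_dot // cd mul0r.
  by rewrite pairing_dot // dotC cd mul0r.
have sA : {subset A <= roots D} by move=> c /AP[].
have aA : a0 \in A.
  apply/AP; split; first exact: highest_root.
  exists 1%:M; first by constructor.
  by rewrite mulmx1 gt_eqF // dot_root_gt0 // highest_root.
have /AP [_ [w Ww bw]] : b \in A.
  by case: (roots_irreducible sA orthp) => e; [move: aA; rewrite e inE|rewrite e].
have ub u : weyl D u -> dot b (a0 *m u) <= dot b a0.
  by move=> Wu; apply/(dominance_dot bd)/(dominant_sub highest_dominant Wu).
have wR := root_weyl Ww highest_root.
have := ub _ (weyl_mul wR Ww); rewrite mulmxA refl_self // dotNr.
by have := ub _ Ww; lia.
Qed.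

(** The coroot of a0 is the highest coroot. For a dominant root b other than
    a0, minimality of the length of a0 gives <a0, b^v> = 1; then b^v - a0^v
    is a coroot that takes the value -1 on a0, so it is a negative coroot. *)
Lemma highest_coroot x b : dominant x -> b \in roots D -> pairing x b^v <= pairing x a0^v.
Proof.
move=> xd; wlog bd : b / dominant b => [h bR|bR].
  have [w Ww d] := dominant_conj D b.
  have wR := root_weyl Ww bR; apply: le_trans (h _ d wR).
  rewrite -(ler_pM2r (dot_root_gt0 bR)) -{2}(dot_weyl _ _ Ww) !pairing_dot //.
  rewrite ler_pM2l //; apply: (dominance_dot xd).
  by have := dominant_sub d (weylV Ww); rewrite (weylK _ Ww).
have aR := highest_root; have [->//|ne] := eqVneq b a0.
have g0 := highest_dot_gt0 bR bd.
have nb := highest_norm bR.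
have P1 : pairing a0 b^v = 1.
  have Pgt : 0 < pairing a0 b^v by rewrite pairing_gt0 // dotC.
  have := pairing_dot a0 bR; rewrite (dotC _ a0) => e.
  have d0 : 0 < dot (b - a0) (b - a0) by rewrite dot_gt0 // subr_eq0.
  move: d0; rewrite !dotBl !dotBr (dotC _ a0 b) => d0.
  have := dot_root_gt0 bR; have := dot_root_gt0 aR.
  move: (pairing a0 b^v) (dot b b) (dot a0 a0) (dot b a0) e Pgt d0 nb g0 => P B A C.
  by move=> e Pgt d0 nb g0 A0 B0; have : P < 2 by [nia]; lia.
have [c cR ec] := reflection_coroot aR bR.
rewrite reflection_mulr P1 scale1r in ec.
have : pairing a0 c^v = -1 by rewrite ec pairingBr P1 pairing_coroot.
case: (positive_neg cR) => cp.
  by have := positive_pairing highest_dominant cp; lia.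
have := positive_pairing xd cp; rewrite corootN // ec pairingNr pairingBr; lia.
Qed.

Lemma highest_pairing_le x y : dominance D x y -> pairing x a0^v <= pairing y a0^v.
Proof.
move=> xy; have aR := highest_root.
rewrite -(ler_pM2r (dot_root_gt0 aR)) !pairing_dot // ler_pM2l //.
by rewrite !(dotC _ _ a0); apply/dominance_dot/xy/highest_dominant.
Qed.

Lemma linked_pairing (p : nat) x la b : (0 < p)%N -> dominant la -> linked D p x la ->
  b \in roots D -> pairing x b^v <= pairing la a0^v.
Proof.
move=> p0 ld l bR; have [w Ww d] := dominant_conj D x.
rewrite -(pairing_weyl x Ww bR); apply: le_trans (highest_coroot d (root_weyl Ww bR)) _.
apply: highest_pairing_le; apply: (@up_dominance _ _ p).
apply: linked_up => //; rewrite -[la]mulmx1.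
by apply: linked_weyl2 => //; constructor.
Qed.

End HighestShort.

(** Bringing t w back to t by simple reflections, each of them raising the
    weight, reads after translation by - p ga as a chain of crossings from
    the end to the start. *)
Lemma linked_translate (p : nat) ga t w : dominant ga -> dominant t -> weyl D w ->
  linked D p (t - ga *+ p) (t *m w - ga *+ p).
Proof.
move=> gd td Ww; set c := ga *+ p.
have cE i : c 0 i = ga 0 i * p%:Z by rewrite /c mulmxnE -mulr_natr natz.
suff h z : forall w, weyl D w -> dominant (z *m w) -> linked D p (z *m w - c) (z - c).
  have := h (t *m w) _ (weylV Ww); rewrite (weylK _ Ww); exact.
elim/(@raise_ind n D): z {Ww td t w} => [z zd|z i zi IH] w Ww zwd.
  by rewrite (dominant_unique zd Ww zwd); apply: chain_refl.
have iR := simple_root_mem D i; set s := s_(al i).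
have Ws : weyl D s by apply: weyl_refl.
have e : z *m s *m (s *m w) = z *m w by rewrite -mulmxA (mulmxA s) reflK ?mul1mx.
have := IH (s *m w) (weylM Ws Ww); rewrite e => /(_ zwd) l.
apply: chain_trans l _; apply: chain1; exists (- al i), (ga 0 i).
have pe x : pairing x (- al i)^v = - x 0 i.
  by rewrite corootN // pairingNr coroot_simple pairing_delta.
split; [exact: rootN|exact: gd| |].
  rewrite pe simple_refl !mxE cE.
  have -> : al i 0 i = 2.
    by rewrite -pairing_delta -(coroot_simple D) pairing_coroot.
  entry_lia.
rewrite affine_reflE reflN // mulmxBl -mulmxA reflK // mulmx1 simple_refl -cE.
by rewrite scalerN opprB addrA [RHS]addrAC addrK.
Qed.

Lemma translate_norm c t u : strictly_dominant c -> strictly_dominant t -> weyl D u ->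
  u <> 1%:M -> dot (t - c) (t - c) < dot (t *m u - c) (t *m u - c).
Proof.
move=> cs ts Wu u1; have d := dominant_sub (strictly_dominantW ts) Wu.
have ne : t *m u <> t by move=> /(strictly_dominant_stab ts Wu).
have := dominance_dot_lt cs d ne.
rewrite !dotBl !dotBr dot_weyl // (dotC _ t c) (dotC _ (t *m u) c); lia.
Qed.

End Bounds.

(** * The product of the group ring *)

Lemma seq_argmax (T : eqType) (s : seq T) (F : T -> int) x0 : x0 \in s ->
  exists2 x, x \in s & forall y, y \in s -> F y <= F x.
Proof.
elim: s x0 => // a s IH x0 _; case: s IH => [|b s] IH.
  by exists a; rewrite ?inE // => y; rewrite inE => /eqP ->.
have [x xs xmax] := IH b (mem_head _ _).
case: (lerP (F a) (F x)) => ax.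
  by exists x => [|y]; rewrite in_cons ?xs ?orbT // => /predU1P[->|/xmax].
exists a; rewrite ?mem_head // => y; rewrite in_cons => /predU1P[->//|/xmax h].
exact: le_trans h (ltW ax).
Qed.

(** Opaque copy of gmul: unification must never compare two unfolded
    products. *)
HB.lock Definition conv n (f g : group_ring n) : group_ring n := gmul f g.

Section GroupRing.
Variable n : nat.
Implicit Types (f g h : group_ring n) (x y z : weight n).

Lemma expoE x z : (expo x)@_z = (x == z)%:R.
Proof. by rewrite /expo mcoeffU. Qed.

Lemma mcoeff_sumg I (r : seq I) (P : pred I) (F : I -> group_ring n) z :
  (\sum_(i <- r | P i) F i)@_z = \sum_(i <- r | P i) (F i)@_z.
Proof. by apply: (big_morph (fun f => f@_z)) => [f g|]; rewrite ?mcoeffD ?mcoeff0. Qed.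

(** Sums over a support are only ever evaluated against a delta function. *)
Lemma sum_supp f (P : pred (weight n)) z :
  \sum_(x <- msupp f | P x) f@_x * (x == z)%:R = if P z then f@_z else 0.
Proof.
case: (msuppP f z) => [zf|zf].
  rewrite big_mkcond (bigD1_seq z) ?fset_uniq //= eqxx mulr1 big1 ?addr0 // => x /negPf->.
  by rewrite mulr0; case: ifP.
rewrite big_seq_cond big1 ?if_same // => x /andP[xf _].
by case: eqP zf => [<-|]; rewrite ?xf ?mulr0.
Qed.

Lemma mcoeff_conv f g z : (conv f g)@_z = \sum_(x <- msupp f) f@_x * g@_(z - x).
Proof.
rewrite unlock mcoeff_sumg; apply: eq_bigr => x _; rewrite mcoeff_sumg.
rewrite -[g@_(z - x)](sum_supp g xpredT) big_distrr; apply: eq_bigr => y _ /=.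
by rewrite mcoeffZ expoE mulrA [x + y]addrC eq_sym -subr_eq eq_sym.
Qed.

Lemma gmul_conv f g : gmul f g = conv f g.
Proof. by rewrite unlock. Qed.

Lemma gmul_comm f g : gmul f g = gmul g f.
Proof.
rewrite /gmul exchange_big; apply: eq_bigr => x _; apply: eq_bigr => y _.
by rewrite mulrC addrC.
Qed.

Lemma convC f g : conv f g = conv g f.
Proof. by rewrite -!gmul_conv; apply: gmul_comm. Qed.

Lemma conv0l h : conv 0 h = 0.
Proof. by rewrite unlock /gmul msupp0 big_nil. Qed.

Lemma mcoeff_convw (S : {fset weight n}) f g z : {subset msupp f <= S} ->
  (conv f g)@_z = \sum_(x <- S) f@_x * g@_(z - x).
Proof.
move=> sub; rewrite mcoeff_conv; apply: big_fset_incl => [|x xS xf]; first exact/fsubsetP.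
by rewrite mcoeff_outdom ?mul0r.
Qed.

Lemma convDl f g h : conv (f + g) h = conv f h + conv g h.
Proof.
apply/malgP => z; rewrite mcoeffD.
pose S := (msupp f `|` msupp g `|` msupp (f + g))%fset.
have [Sf Sg Sfg] : [/\ {subset msupp f <= S}, {subset msupp g <= S} &
    {subset msupp (f + g) <= S}].
  by split=> x; rewrite !in_fsetU => ->; rewrite ?orbT.
rewrite (mcoeff_convw _ _ Sfg) (mcoeff_convw _ _ Sf) (mcoeff_convw _ _ Sg).
transitivity (\sum_(x <- S) (f@_x * h@_(z - x) + g@_x * h@_(z - x))).
  by apply: eq_bigr => x _; rewrite mcoeffD mulrDl.
by rewrite big_split.
Qed.

Lemma convZl c f h : conv (c *: f) h = c *: conv f h.
Proof.
apply/malgP => z; rewrite mcoeffZ (@mcoeff_convw (msupp f)); last exact/fsubsetP/msuppZ_le.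
by rewrite mcoeff_conv big_distrr; apply: eq_bigr => x _ /=; rewrite mcoeffZ mulrA.
Qed.

Lemma conv_suml I (r : seq I) (P : pred I) (F : I -> group_ring n) h :
  conv (\sum_(i <- r | P i) F i) h = \sum_(i <- r | P i) conv (F i) h.
Proof.
by apply: (big_morph (fun f => conv f h)) => [f g|]; rewrite ?convDl ?conv0l.
Qed.

Lemma mcoeff_conv_expo x g z : (conv (expo x) g)@_z = g@_(z - x).
Proof.
rewrite (@mcoeff_convw [fset x]%fset); last exact/fsubsetP/msuppU_le.
by rewrite big_seq_fset1 expoE eqxx mul1r.
Qed.

Lemma conv_sum_expo f h : conv f h = \sum_(x <- msupp f) f@_x *: conv (expo x) h.
Proof.
apply/malgP => z; rewrite mcoeff_sumg mcoeff_conv; apply: eq_bigr => x _.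
by rewrite mcoeffZ mcoeff_conv_expo.
Qed.

Lemma convA f g h : conv f (conv g h) = conv (conv f g) h.
Proof.
apply: etrans (conv_sum_expo f (conv g h)) _; rewrite (conv_sum_expo f g) conv_suml.
apply: eq_bigr => x _; rewrite convZl; congr (_ *: _); apply/malgP => z.
rewrite mcoeff_conv_expo (convC g h) (convC _ h) mcoeff_conv [RHS]mcoeff_conv.
by apply: eq_bigr => y _; rewrite mcoeff_conv_expo addrAC.
Qed.

End GroupRing.

(** * Weyl characters *)

Section Characters.
Variables (n : nat) (D : root_datum n).
Implicit Types (x y z t : weight n) (f g h M eta c : group_ring n).
Local Notation s_ a := (root_reflection D a).
Local Notation al := (simple_root D).
Local Notation dot := (dot D).
Local Notation W := (fset_set (weyl D)).
Local Notation alt := (alternating_sum D).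
Local Notation rho := (rho n).

Definition skew f := forall w, weyl D w -> forall x, f@_(x *m w) = \det w * f@_x.

Lemma in_W w : (w \in W) <-> weyl D w.
Proof. by rewrite in_fset_set ?inE //; apply: finite_weyl. Qed.

Lemma sum_W (V : zmodType) (F : 'M[int]_n -> V) :
  \sum_(w \in weyl D) F w = \sum_(w <- W) F w.
Proof. by rewrite fsbig_finite //; apply: finite_weyl. Qed.

Lemma sum_W1 (F : 'M[int]_n -> int) :
  (forall w, weyl D w -> w <> 1%:M -> F w = 0) -> \sum_(w <- W) F w = F 1%:M.
Proof.
move=> h; rewrite (bigD1_seq 1%:M) ?fset_uniq //=; last by apply/in_W; constructor.
by rewrite big_seq_cond big1 ?addr0 // => w /andP[/in_W Ww /eqP]; apply: h.
Qed.

Lemma sum_W_inv (F : 'M[int]_n -> int) :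
  \sum_(w <- W) F (invmx w) = \sum_(w <- W) F w.
Proof.
rewrite -(big_map (@invmx int n) predT); apply: perm_big; apply: uniq_perm.
- by rewrite map_inj_uniq ?fset_uniq //; apply: (can_inj (@invmxK _ _)).
- exact: fset_uniq.
move=> w; apply/mapP/idP => [[u /in_W Wu ->]|/in_W Ww].
  by apply/in_W/weylV.
by exists (invmx w); rewrite ?invmxK //; apply/in_W/weylV.
Qed.

Lemma perm_supp f w : weyl D w ->
  (forall x, f@_x != 0 -> f@_(x *m w) != 0) ->
  perm_eq [seq x *m w | x <- msupp f] (msupp f).
Proof.
move=> Ww h.
have u : uniq [seq x *m w | x <- msupp f].
  rewrite map_inj_uniq ?fset_uniq //.
  by apply: (can_inj (g := fun x => x *m invmx w)) => x; apply: weylK Ww.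
apply: uniq_perm; rewrite ?fset_uniq //; apply: (uniq_min_size u _ _).2.
  by move=> z /mapP [x xf ->]; rewrite -mcoeff_neq0 h // mcoeff_neq0.
by rewrite size_map.
Qed.

Lemma det_weyl_neq0 w : weyl D w -> \det w != 0.
Proof. by case/det_weyl => ->. Qed.

Lemma conv_skew f g : weyl_invariant D f -> skew g -> skew (conv f g).
Proof.
move=> fi gs w Ww z; rewrite [LHS]mcoeff_conv -(perm_big _ (perm_supp Ww _)) /=; last first.
  by move=> x; rewrite fi.
rewrite big_map mcoeff_conv big_distrr; apply: eq_bigr => x _ /=.
by rewrite fi // -mulmxBl gs // mulrCA.
Qed.

Lemma conv_invariant f g : weyl_invariant D f -> weyl_invariant D g ->
  weyl_invariant D (conv f g).
Proof.
move=> fi gi w Ww z; rewrite [LHS]mcoeff_conv -(perm_big _ (perm_supp Ww _)) /=; last first.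
  by move=> x; rewrite fi.
rewrite big_map mcoeff_conv; apply: eq_bigr => x _ /=.
by rewrite fi // -mulmxBl gi.
Qed.

Lemma invariantD f g : weyl_invariant D f -> weyl_invariant D g -> weyl_invariant D (f + g).
Proof. by move=> fi gi w Ww x; rewrite !mcoeffD fi // gi. Qed.
Lemma invariantZ k f : weyl_invariant D f -> weyl_invariant D (k *: f).
Proof. by move=> fi w Ww x; rewrite !mcoeffZ fi. Qed.
Lemma invariant0 : weyl_invariant D (0 : group_ring n).
Proof. by move=> w Ww x; rewrite !mcoeff0. Qed.
Lemma skewD f g : skew f -> skew g -> skew (f + g).
Proof. by move=> fi gi w Ww x; rewrite !mcoeffD fi // gi // mulrDr. Qed.
Lemma skewZ k f : skew f -> skew (k *: f).
Proof. by move=> fi w Ww x; rewrite !mcoeffZ fi // mulrCA. Qed.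
Lemma skew0 : skew 0.
Proof. by move=> w Ww x; rewrite !mcoeff0 mulr0. Qed.
Lemma skewB f g : skew f -> skew g -> skew (f - g).
Proof. by move=> fi gi; apply: skewD => //; rewrite -scaleN1r; apply: skewZ. Qed.

Lemma alt_sum t : alt t = \sum_(w <- W) \det w *: expo (t *m w).
Proof. exact: sum_W. Qed.

Lemma altE t x : (alt t)@_x = \sum_(w <- W) \det w * (t *m w == x)%:R.
Proof.
by rewrite alt_sum mcoeff_sumg; apply: eq_bigr => w _; rewrite mcoeffZ expoE.
Qed.

(** Expanding the alternating sum and using the invariance of M. *)
Lemma mcoeff_conv_alt M t z : weyl_invariant D M ->
  (conv M (alt t))@_z = \sum_(u <- W) \det u * M@_(z *m u - t).
Proof.
move=> Mi; rewrite convC alt_sum conv_suml mcoeff_sumg -[RHS]sum_W_inv.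
rewrite big_seq [RHS]big_seq; apply: eq_bigr => w /in_W Ww.
rewrite convZl mcoeffZ mcoeff_conv_expo (det_weylV Ww); congr (_ * _).
by rewrite -(Mi _ (weylV Ww)) mulmxBl (weylK _ Ww).
Qed.

Lemma weyl1 : weyl D 1%:M.
Proof. by constructor. Qed.

Lemma sum_W_mul (F : 'M[int]_n -> int) u : weyl D u ->
  \sum_(w <- W) F (w *m u) = \sum_(w <- W) F w.
Proof.
move=> Wu; rewrite -(big_map (fun w => w *m u) predT); apply: perm_big; apply: uniq_perm.
- rewrite map_inj_uniq ?fset_uniq //; apply: (can_inj (g := fun w => w *m invmx u)) => w.
  by rewrite mulmxK // (weyl_unit Wu).
- exact: fset_uniq.
move=> w; apply/mapP/idP => [[v /in_W Wv ->]|/in_W Ww].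
  by apply/in_W/weylM.
exists (w *m invmx u); first by apply/in_W/weylM/weylV.
by rewrite mulmxKV // (weyl_unit Wu).
Qed.

Lemma alt_skew t : skew (alt t).
Proof.
move=> u Wu x; rewrite !altE -[LHS](sum_W_mul _ Wu) big_distrr /=.
apply: eq_bigr => w _; rewrite det_mulmx mulmxA mulrA [\det u * _]mulrC.
have inj : injective (fun y : weight n => y *m u).
  by apply: (can_inj (g := fun y => y *m invmx u)) => y; apply: weylK Wu.
by congr (_ * _%:R); rewrite (inj_eq inj).
Qed.

Lemma dominant_agree f g : weyl_invariant D f -> weyl_invariant D g ->
  (forall x, dominant x -> f@_x = g@_x) -> f = g.
Proof.
move=> fi gi h; apply/malgP => x; have [w Ww d] := dominant_conj D x.
by rewrite -(fi w Ww) -(gi w Ww) h.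
Qed.

Lemma skew_eq0 f x : skew f -> dominant x -> ~ strictly_dominant x -> f@_x = 0.
Proof.
move=> fs xd /existsNP [i /negP]; rewrite -leNgt => xi.
have e : x 0 i = 0 by apply/eqP; rewrite eq_le xi xd.
have iR := simple_root_mem D i.
have := fs _ (weyl_refl iR) x; rewrite simple_refl e scale0r subr0 det_refl //.
by move: (f@_x) => k; lia.
Qed.

(** A skew element vanishes on the walls of the dominant chamber, since its
    values there are equal to their opposites. *)
Lemma skew_agree f g : skew f -> skew g ->
  (forall x, strictly_dominant x -> f@_x = g@_x) -> f = g.
Proof.
move=> fs gs h; apply/malgP => x; have [w Ww d] := dominant_conj D x.
apply: (mulfI (det_weyl_neq0 Ww)); rewrite -fs // -gs //.
by case: (pselect (strictly_dominant (x *m w))) => [/h //|nd]; rewrite !skew_eq0.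
Qed.

Lemma alt_strict t x : strictly_dominant t -> strictly_dominant x ->
  (alt t)@_x = (t == x)%:R.
Proof.
move=> ts xs; rewrite altE sum_W1; first by rewrite det1 mul1r mulmx1.
move=> w Ww w1; case: eqP => [e|]; rewrite ?mulr0 //.
have := dominant_unique (strictly_dominantW ts) Ww; rewrite e => /(_ (strictly_dominantW xs)).
by move=> ext; case: w1; apply: (strictly_dominant_stab ts Ww); rewrite e ext.
Qed.

Lemma orbitE mu x : (orbit_sum D mu)@_x = (`[< weyl_orbit D mu x >])%:R.
Proof.
have fin : finite_set (weyl_orbit D mu) by apply/finite_image/finite_weyl.
rewrite /orbit_sum fsbig_finite //= mcoeff_sumg.
under eq_bigr do rewrite expoE.
case: asboolP => h.
  have xin : x \in fset_set (weyl_orbit D mu) by rewrite in_fset_set ?inE.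
  by rewrite (bigD1_seq x) ?fset_uniq //= eqxx big1 ?addr0 // => y /negPf->.
rewrite big_seq big1 // => y; rewrite in_fset_set // inE => yo.
by case: eqP => // e; case: h; rewrite -e.
Qed.

Lemma weyl_orbitM mu x w : weyl D w -> weyl_orbit D mu (x *m w) <-> weyl_orbit D mu x.
Proof.
move=> Ww; split=> -[u Wu e].
  exists (u *m invmx w); first by apply: weylM => //; apply: weylV.
  by rewrite mulmxA e (weylK _ Ww).
by exists (u *m w); [apply: weylM|rewrite mulmxA e].
Qed.

Lemma orbit_invariant mu : weyl_invariant D (orbit_sum D mu).
Proof.
by move=> w Ww x; rewrite !orbitE (asbool_equiv_eq (weyl_orbitM mu x Ww)).
Qed.

Lemma orbit_dominant mu x : dominant mu -> dominant x -> (orbit_sum D mu)@_x = (mu == x)%:R.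
Proof.
move=> md xd; rewrite orbitE; case: asboolP => [[w Ww e]|h].
  by rewrite -e in xd *; rewrite (dominant_unique md Ww xd) eqxx.
by case: eqP => // e; case: h; exists 1%:M; [exact: weyl1|rewrite mulmx1].
Qed.

(** Each root contributes the product of two numbers of the same sign. *)
Lemma dot_dominant_ge0 x y : dominant x -> dominant y -> 0 <= dot x y.
Proof.
move=> xd yd; have -> : dot x y =
  \sum_(b <- roots D) pairing x (coroot D b) * pairing y (coroot D b) by [].
rewrite big_seq; apply: sumr_ge0 => b bR.
case: (positive_neg bR) => bp.
  by rewrite mulr_ge0 // positive_pairing.
have := positive_pairing xd bp; have := positive_pairing yd bp.
by rewrite corootN // !pairingNr !oppr_ge0 => h1 h2; rewrite mulr_le0.
Qed.

(** The product is nonzero at x + rho, for x an exponent of f of largest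
    scalar product with rho. *)
Lemma conv_alt_eq0 f : conv f (alt rho) = 0 -> f = 0.
Proof.
move=> e; case: (fset_0Vmem (msupp f)) => [f0|[x0 x0f]].
  by apply/malgP => z; rewrite mcoeff0 mcoeff_outdom // f0 in_fset0.
have [x xf xmax] := seq_argmax (dot rho) x0f.
have : (conv f (alt rho))@_(x + rho) = f@_x.
  rewrite convC alt_sum conv_suml mcoeff_sumg.
  have -> : f@_x = \det (1%:M : 'M[int]_n) * f@_(x + rho - rho *m 1%:M).
    by rewrite det1 mul1r mulmx1 addrK.
  under eq_bigr do rewrite convZl mcoeffZ mcoeff_conv_expo.
  rewrite sum_W1 // => w Ww w1; rewrite mcoeff_outdom ?mulr0 //.
  apply/negP => /xmax; rewrite dotBr dotDr.
  have := dominance_dot_lt (@rho_strict n) (dominant_sub (strictly_dominantW (@rho_strict n)) Ww).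
  move=> /(_ (fun e => w1 (strictly_dominant_stab (@rho_strict n) Ww e))).
  lia.
by rewrite e mcoeff0 => f0; move: xf; rewrite -mcoeff_neq0 -f0 eqxx.
Qed.

Lemma conv_alt_cancel f g : conv f (alt rho) = conv g (alt rho) -> f = g.
Proof.
move=> e; apply/eqP; rewrite -subr_eq0; apply/eqP/conv_alt_eq0.
by rewrite convDl -scaleN1r convZl e scaleN1r subrr.
Qed.

Lemma skew_decomposition f : skew f ->
  f = \sum_(t <- msupp f | `[< strictly_dominant t >]) f@_t *: alt t.
Proof.
move=> fs; apply: skew_agree => //.
  by elim/big_rec: _ => [|t g _ gs]; [exact: skew0|apply/skewD/gs/skewZ/alt_skew].
move=> x xs; rewrite mcoeff_sumg.
under eq_bigr => t /asboolP ts do rewrite mcoeffZ alt_strict //.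
by rewrite sum_supp; case: asboolP.
Qed.

(** The product of the alternating sum of rho with the orbit sum of t - rho
    is the alternating sum of t plus skew terms lower than t, which are
    divisible by induction. *)
Lemma alt_divisible t : strictly_dominant t ->
  exists2 eta, weyl_invariant D eta & conv eta (alt rho) = alt t.
Proof.
have [m] := ubnP `|dot rho t|; elim: m t => // m IH t lt_m ts.
have rs := @rho_strict n; have rd := strictly_dominantW rs.
set f := conv (orbit_sum D (t - rho)) (alt rho).
have td : dominant (t - rho) by apply/dominant_rho; rewrite subrK.
have oi := orbit_invariant (t - rho).
have fs : skew f by apply: conv_skew => //; apply: alt_skew.
have gs : skew (alt t - f) by apply: skewB => //; apply: alt_skew.
have ft : f@_t = 1.
  rewrite mcoeff_conv_alt // sum_W1; first by rewrite det1 mul1r mulmx1 orbit_dominant ?eqxx.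
  move=> u Wu u1; rewrite orbitE; case: asboolP => [[w Ww e]|]; rewrite ?mulr0 //.
  have := translate_norm rs ts Wu u1.
  by rewrite -e dot_weyl // ltxx.
have low x : strictly_dominant x -> (alt t - f)@_x != 0 -> dot rho x < dot rho t.
  move=> xs; rewrite mcoeffB alt_strict //; case: (eqVneq t x) => [<-|ne].
    by rewrite ft subrr eqxx.
  rewrite sub0r oppr_eq0 => fx.
  have [u Wu [w Ww e]] : exists2 u, weyl D u & weyl_orbit D (t - rho) (x *m u - rho).
    apply: contrapT => h; move/eqP: fx; apply; rewrite mcoeff_conv_alt // big_seq big1 //.
    move=> u /in_W Wu; rewrite orbitE; case: asboolP; rewrite ?mulr0 // => o.
    by case: h; exists u.
  have WV := weylV Wu.
  have ex : x = (t - rho) *m (w *m invmx u) + rho *m invmx u.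
    by rewrite mulmxA e -mulmxDl subrK (weylK _ Wu).
  have d1 := dominance_dot rd (dominant_sub td (weylM Ww WV)).
  have d2 := dominance_dot rd (dominant_sub rd WV).
  have et : dot rho t = dot rho (t - rho) + dot rho rho by rewrite -dotDr subrK.
  have ed : dot rho x = dot rho ((t - rho) *m (w *m invmx u)) + dot rho (rho *m invmx u).
    by rewrite -dotDr -ex.
  rewrite lt_neqAle et ed lerD // andbT; apply/eqP => eq.
  have e1 : rho *m invmx u = rho.
    apply: contrapT => ne1; have := dominance_dot_lt rs (dominant_sub rd WV) ne1.
    by move: eq d1; lia.
  have e2 : (t - rho) *m (w *m invmx u) = t - rho.
    apply: contrapT => ne2; have := dominance_dot_lt rs (dominant_sub td (weylM Ww WV)) ne2.
    by move: eq d2; lia.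
  by case/eqP: ne; rewrite ex e1 e2 subrK.
have [eta ei ee] : exists2 eta, weyl_invariant D eta & conv eta (alt rho) = alt t - f.
  move: (alt t - f) gs low => g gs low; rewrite (skew_decomposition gs) big_seq_cond.
  elim/big_rec: _ => [|x g' /andP[xg /asboolP xs] [eta ei <-]].
    by exists 0; [exact: invariant0|exact: conv0l].
  have [|eta' ei' ee'] := IH x _ xs.
    have lt : dot rho x < dot rho t by apply: low; rewrite ?mcoeff_neq0.
    have := dot_dominant_ge0 rd (strictly_dominantW xs); lia.
  exists (g@_x *: eta' + eta).
    exact: invariantD (invariantZ _ ei') ei.
  by rewrite convDl convZl ee'.
exists (orbit_sum D (t - rho) + eta); first exact: invariantD oi ei.
by rewrite convDl ee addrC subrK.
Qed.

(** The quotient that defines the Weyl character exists by divisibility and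
    is unique by cancellation. *)
Lemma weyl_charP la : dominant la ->
  weyl_invariant D (weyl_char D la) /\ conv (weyl_char D la) (alt rho) = alt (la + rho).
Proof.
move=> ld; have [|eta ei ee] := @alt_divisible (la + rho); first exact/dominant_rho.
have : [set chi | gmul chi (alt rho) = alt (la + rho)] (weyl_char D la).
  by apply: (@xgetPex _ 0); exists eta => /=; rewrite -ee unlock.
rewrite /= gmul_conv => e; split => //.
by have -> : weyl_char D la = eta by apply: conv_alt_cancel; rewrite e ee.
Qed.

Lemma expansion_alt c t : {in msupp c, forall la, dominant la} -> strictly_dominant t ->
  (conv (\sum_(la <- msupp c) c@_la *: weyl_char D la) (alt rho))@_t = c@_(t - rho).
Proof.
move=> cd ts; rewrite conv_suml mcoeff_sumg.
transitivity (\sum_(la <- msupp c | xpredT la) c@_la * (la == t - rho)%:R).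
  rewrite big_seq [RHS]big_seq; apply: eq_bigr => la lc.
  have ld := cd _ lc; have ls : strictly_dominant (la + rho) by apply/dominant_rho.
  rewrite convZl mcoeffZ (weyl_charP ld).2 alt_strict //.
  by rewrite eq_sym -subr_eq eq_sym.
by rewrite sum_supp.
Qed.

Lemma expansion_skew c : {in msupp c, forall la, dominant la} ->
  skew (conv (\sum_(la <- msupp c) c@_la *: weyl_char D la) (alt rho)).
Proof.
move=> cd; apply: conv_skew; last exact: alt_skew.
rewrite big_seq; elim/big_rec: _ => [|la g lc gi]; first exact: invariant0.
by apply/invariantD/gi/invariantZ/(weyl_charP (cd _ lc)).1.
Qed.

(** Multiplying by the alternating sum of rho turns coefficients on Weyl
    characters into coefficients on exponentials. *)
Lemma basis_coef_weyl eta la : weyl_invariant D eta -> dominant la ->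
  basis_coef (weyl_char D) eta la = (conv eta (alt rho))@_(la + rho).
Proof.
move=> ei ld; have ls : strictly_dominant (la + rho) by apply/dominant_rho.
rewrite /basis_coef; set E := [set c | _].
have : E (xget 0 E).
  apply: (@xgetPex _ 0); set f := conv eta (alt rho).
  have fs : skew f by apply: conv_skew => //; apply: alt_skew.
  pose c : group_ring n := \sum_(t <- msupp f | `[< strictly_dominant t >]) f@_t *: expo (t - rho).
  have cE mu : c@_mu = if `[< strictly_dominant (mu + rho) >] then f@_(mu + rho) else 0.
    rewrite mcoeff_sumg -(sum_supp f (fun t => `[< strictly_dominant t >]) (mu + rho)).
    by apply: eq_bigr => t _; rewrite mcoeffZ expoE subr_eq.
  have cd : {in msupp c, forall mu, dominant mu}.
    move=> mu; rewrite -mcoeff_neq0 cE; case: asboolP; rewrite ?eqxx //.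
    by move/dominant_rho.
  exists c; split => //; apply: conv_alt_cancel; apply: skew_agree => //.
    exact: expansion_skew.
  by move=> t ts; rewrite expansion_alt // cE subrK asboolT.
move=> [cd e]; have := expansion_alt cd ls.
by rewrite -e addrK.
Qed.

Lemma basis_coef_orbit M mu : weyl_invariant D M -> dominant mu ->
  basis_coef (orbit_sum D) M mu = M@_mu.
Proof.
have coefE c x : {in msupp c, forall la, dominant la} -> dominant x ->
    (\sum_(la <- msupp c) c@_la *: orbit_sum D la)@_x = c@_x.
  move=> cd xd; rewrite mcoeff_sumg.
  transitivity (\sum_(la <- msupp c | xpredT la) c@_la * (la == x)%:R).
    rewrite big_seq [RHS]big_seq; apply: eq_bigr => la lc.
    by rewrite mcoeffZ orbit_dominant //; apply: cd.
  by rewrite sum_supp.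
move=> Mi md; rewrite /basis_coef; set E := [set c | _].
have : E (xget 0 E).
  apply: (@xgetPex _ 0).
  pose c : group_ring n := \sum_(t <- msupp M | `[< dominant t >]) M@_t *: expo t.
  have cE x : c@_x = if `[< dominant x >] then M@_x else 0.
    rewrite mcoeff_sumg -(sum_supp M (fun t => `[< dominant t >]) x).
    by apply: eq_bigr => t _; rewrite mcoeffZ expoE.
  have cd : {in msupp c, forall x, dominant x}.
    by move=> x; rewrite -mcoeff_neq0 cE; case: asboolP; rewrite ?eqxx.
  exists c; split; first exact: cd.
  apply: (dominant_agree Mi); last first.
    by move=> x xd; rewrite coefE // cE asboolT.
  elim/big_rec: _ => [|t g _ gi]; first exact: invariant0.
  exact: invariantD (invariantZ _ (@orbit_invariant _)) gi.
by move=> [cd e]; rewrite -(coefE _ _ cd md) -e.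
Qed.

End Characters.

(** * Products with Steinberg characters *)

Lemma finite_least (S : set int) : finite_set S -> S !=set0 -> exists x, is_least S x.
Proof.
move=> fS [x0 x0S].
have mem x : x \in fset_set S <-> S x by rewrite in_fset_set // inE.
have [x /mem xS xmax] := seq_argmax (fun x => - x) ((mem _).2 x0S).
by exists x; split => // y /mem /xmax; lia.
Qed.

Section Restricted.
Variable n : nat.
Implicit Types (x ga : weight n).

Lemma restrictedP (k : int) ga : restricted k ga <-> forall i, 0 <= ga 0 i < k.
Proof.
have E (a : 'I_n -> int) i : (\sum_j a j *: fundamental_weight j) 0 i = a i.
  rewrite summxE (bigD1 i) //= !mxE !eqxx mulr1 big1 ?addr0 // => j ji.
  by rewrite !mxE eq_sym (negPf ji) mulr0.
split=> [[a a_bd ->] i|h]; first by rewrite E.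
by exists (fun i => ga 0 i) => //; apply/rowP => i; rewrite E.
Qed.

Lemma finite_restricted (k : int) : finite_set (@restricted n k).
Proof.
pose f (h : {ffun 'I_n -> 'I_(`|k|.+1)}) : weight n := \row_i (h i : nat)%:Z.
apply: (@sub_finite_set _ _ (range f)); last exact/finite_image/finite_finset.
move=> x /restrictedP x_bd /=; exists [ffun i => inord `|(x 0%R i)%R|%N] => //.
apply/rowP => i; rewrite mxE ffunE inordK; last by have := x_bd i; entry_lia.
by have := x_bd i; entry_lia.
Qed.

End Restricted.

Section Products.
Variables (n : nat) (D : root_datum n) (p : nat).
Hypothesis p_gt0 : (0 < p)%N.
Implicit Types (x y z t g ga mu : weight n) (M N : group_ring n).
Local Notation "a '^v'" := (coroot D a) (at level 2, format "a '^v'").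
Local Notation s_ a := (root_reflection D a).
Local Notation al := (simple_root D).
Local Notation dot := (dot D).
Local Notation W := (fset_set (weyl D)).
Local Notation rho := (rho n).
Local Notation linked := (linked D p).

(** The coefficient of chi(t - rho) in M chi(c - rho). *)
Definition brauer_coef M t c : int := \sum_(u <- W) \det u * M@_(t *m u - c).

Lemma steinberg_rho ga : steinberg_weight p ga + rho = (ga + rho) *+ p.
Proof.
rewrite /steinberg_weight mulrnDl addrAC -mulrSr (prednK p_gt0) addrC //.
Qed.

Lemma mulrn_coord g i : (g *+ p) 0 i = p%:Z * g 0 i.
Proof. by rewrite mulmxnE -mulr_natr natz mulrC. Qed.

Lemma strictly_dominantMn g : strictly_dominant g -> strictly_dominant (g *+ p).
Proof. by move=> gs i; rewrite mulrn_coord mulr_gt0 // gs. Qed.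

Lemma pairingMn g (v : coweight n) : pairing (g *+ p) v = p%:Z * pairing g v.
Proof. by rewrite -pairingZl -[p%:Z]natz scaler_nat. Qed.

Lemma steinberg_dominant ga : dominant ga -> dominant (steinberg_weight p ga).
Proof.
move=> gd; apply/dominant_rho; rewrite steinberg_rho.
by apply/strictly_dominantMn/dominant_rho.
Qed.

(** Brauer's formula, with c - rho a weight of the form (p - 1) rho + p ga. *)
Lemma brauer M ga la : weyl_invariant D M -> dominant ga -> dominant la ->
  basis_coef (weyl_char D) (gmul M (weyl_char D (steinberg_weight p ga))) la =
  brauer_coef M (la + rho) ((ga + rho) *+ p).
Proof.
move=> Mi gd ld; have [ci ce] := weyl_charP D (steinberg_dominant gd).
rewrite gmul_conv basis_coef_weyl //; last exact: conv_invariant.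
by rewrite -convA ce mcoeff_conv_alt // steinberg_rho.
Qed.

Lemma brauerC M ga la : weyl_invariant D M -> dominant ga -> dominant la ->
  basis_coef (weyl_char D) (gmul (weyl_char D (steinberg_weight p ga)) M) la =
  brauer_coef M (la + rho) ((ga + rho) *+ p).
Proof.
by move=> Mi gd ld; rewrite gmul_comm; apply: brauer.
Qed.

(** The terms other than M y involve weights strictly above y, in the
    linkage order and for the norm. *)
Lemma brauer_term g y u : strictly_dominant g -> strictly_dominant (g *+ p + y) ->
  weyl D u -> u <> 1%:M ->
  linked y ((g *+ p + y) *m u - g *+ p) /\
  dot y y < dot ((g *+ p + y) *m u - g *+ p) ((g *+ p + y) *m u - g *+ p).
Proof.
move=> gs ts Wu u1; set c := g *+ p.
have := linked_translate p (strictly_dominantW gs) (strictly_dominantW ts) Wu.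
have := translate_norm (strictly_dominantMn gs) ts Wu u1.
by rewrite -/c [c + y - c]addrAC subrr add0r.
Qed.

(** The coefficient depends on M y and, through brauer_term, on the values
    of M strictly above y. *)
Lemma brauer_coef_eq M N g y : strictly_dominant g -> strictly_dominant (g *+ p + y) ->
  (forall z, linked y z -> dot y y < dot z z -> M@_z = N@_z) ->
  brauer_coef M (g *+ p + y) (g *+ p) - M@_y = brauer_coef N (g *+ p + y) (g *+ p) - N@_y.
Proof.
move=> gs ts h.
have W1 : 1%:M \in W by apply/in_W; constructor.
rewrite /brauer_coef !(bigD1_seq 1%:M) ?fset_uniq //= !det1 !mul1r !mulmx1.
have -> : g *+ p + y - g *+ p = y by rewrite addrAC subrr add0r.
have E : \sum_(u <- W | u != 1%:M) \det u * M@_((g *+ p + y) *m u - g *+ p) =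
    \sum_(u <- W | u != 1%:M) \det u * N@_((g *+ p + y) *m u - g *+ p).
  rewrite big_seq_cond [RHS]big_seq_cond; apply: eq_bigr => u /andP[/in_W Wu /eqP u1].
  by have [l d] := brauer_term gs ts Wu u1; rewrite h.
by rewrite E; move: (\sum_(_ <- _ | _) _) (M@_y) (N@_y) => S i j; lia.
Qed.

Lemma linked_norm la x : dominant la -> linked x la -> dot x x <= dot la la.
Proof.
move=> ld l; have [w Ww xd] := dominant_conj D x; rewrite -(dot_weyl x x Ww).
have dl : dominance D (x *m w) la.
  apply: (@up_dominance _ _ p); apply: linked_up => //; rewrite -[la]mulmx1.
  by apply: linked_weyl2 => //; constructor.
apply: le_trans (dominance_dot xd dl) _.
by rewrite dotC; apply: dominance_dot.
Qed.


Section Level.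
Variables (a0 la : weight n) (m : int).
Hypothesis a0_highest : highest_short_root D a0.
Hypothesis la_dominant : dominant la.
Hypothesis m_level : level D p la a0 m.

Lemma linked_bound x b : linked x la -> b \in roots D -> - pairing x b^v < p%:Z * m.
Proof.
move=> l bR; rewrite -pairingNr -corootN //; have lt : pairing la a0^v < p%:Z * m := m_level.1.
apply: le_lt_trans lt; exact: (@linked_pairing _ _ _ a0_highest _ _ _ _ p_gt0 la_dominant l (rootN bR)).
Qed.

Lemma linked_coord x i : linked x la -> - x 0 i < p%:Z * m.
Proof.
move=> l; have := linked_bound l (simple_root_mem D i).
by rewrite coroot_simple pairing_delta.
Qed.

Lemma level_gt0 : 0 < m.
Proof.
have := linked_bound (chain_refl _ la) (highest_root a0_highest).
have h : 0 <= pairing la a0^v.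
  case: (positive_neg (highest_root a0_highest)) => [|] ap; first exact: positive_pairing.
  have := positive_pairing (highest_dominant a0_highest) ap.
  by rewrite corootN ?highest_root // pairingNr pairing_coroot // highest_root.
have lt : pairing la a0^v < p%:Z * m := m_level.1.
move=> _; have : 0 < p%:Z * m by apply: le_lt_trans lt.
by rewrite pmulr_rgt0.
Qed.

(** If e is not fixed by u, some root with a positive value on e has a
    non-positive value on t u; but on g p that root takes a value of at
    least p m, more than can be compensated by a weight linked to la. *)
Lemma linked_stab e g t u : dominant e -> dominant g -> dominant t -> weyl D u ->
  (forall i, 0 < e 0 i -> m <= g 0 i) -> linked (t *m u - g *+ p) la -> e *m u = e.
Proof.
move=> ed gd td Wu eg l; apply: (dominant_stab ed td Wu) => b bR eb.
have [i [bp ei bi]] := pairing_gt0_coord ed bR eb.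
have := pairing_ge_coord gd bp bi (ltW level_gt0) (eg _ ei).
have := linked_bound l bR; rewrite pairingBl pairingMn => h1 h2.
have : p%:Z * m <= p%:Z * pairing g b^v by rewrite ler_pM2l.
lia.
Qed.

Variable M : group_ring n.
Hypothesis M_linked : forall x, M@_x != 0 -> linked x la.

(** Truncating the coordinates of ga at m - 1 changes no term: for u fixing
    the difference e the arguments of M coincide, and for the other u both
    of them lie outside the support of M. *)
Lemma brauer_coef_reduce ga y : dominant ga ->
  strictly_dominant ((ga + rho) *+ p + y) -> linked y la ->
  exists gb, [/\ restricted m gb, strictly_dominant ((gb + rho) *+ p + y) &
    brauer_coef M ((ga + rho) *+ p + y) ((ga + rho) *+ p) =
    brauer_coef M ((gb + rho) *+ p + y) ((gb + rho) *+ p)].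
Proof.
move=> gd ts ly; have m0 := level_gt0.
pose gb : weight n := \row_i Num.min (ga 0 i) (m - 1).
have gbE i : gb 0 i = Num.min (ga 0 i) (m - 1) by rewrite mxE.
have gb_bd i : 0 <= gb 0 i < m.
  by have := gd i; rewrite gbE; case: leP; entry_lia.
have bs : strictly_dominant (gb + rho).
  by apply/dominant_rho => i; case/andP: (gb_bd i).
have gs : strictly_dominant (ga + rho) by apply/dominant_rho.
have ts' : strictly_dominant ((gb + rho) *+ p + y).
  move=> i; have := ts i; rewrite mxE mulrn_coord mxE [in X in _ -> X]mxE mulrn_coord.
  rewrite [(gb + rho) 0 i]mxE gbE rho_coord; have := linked_coord i ly.
  by case: leP; rewrite ?subrK; entry_lia.
exists gb; split => //.
  exact/restrictedP.
pose e := ga - gb; have ed : dominant e.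
  by move=> i; rewrite !mxE; case: leP; entry_lia.
have eg i : 0 < e 0 i -> m <= (gb + rho) 0 i.
  by rewrite !mxE rho_coord; case: leP; entry_lia.
have eg' i : 0 < e 0 i -> m <= (ga + rho) 0 i.
  by rewrite !mxE rho_coord; case: leP; entry_lia.
rewrite /brauer_coef big_seq [RHS]big_seq; apply: eq_bigr => u /in_W Wu; congr (_ * _).
have [eu|ne] := eqVneq (e *m u) e.
  have -> : (ga + rho) *+ p = (gb + rho) *+ p + e *+ p.
    by rewrite -mulrnDl /e addrAC [gb + _]addrC subrK.
  congr (M@_ _); rewrite [_ + e *+ p + y]addrAC mulmxDl.
  have -> : (e *+ p) *m u = e *+ p by rewrite -scaler_nat -scalemxAl eu scaler_nat.
  by rewrite opprD addrA [_ - (e *+ p)]addrAC addrK.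
have [sg sb] := (strictly_dominantW gs, strictly_dominantW bs).
have [st sb'] := (strictly_dominantW ts, strictly_dominantW ts').
rewrite [LHS](_ : _ = 0); last first.
  by apply: contrapT => /eqP /M_linked /(linked_stab ed sg st Wu eg') /eqP; apply/negP.
apply: esym; apply: contrapT => /eqP /M_linked /(linked_stab ed sb sb' Wu eg) /eqP.
exact/negP.
Qed.

End Level.

End Products.

(** * Negative coefficients *)

Section Negativity.
Variables (n : nat) (D : root_datum n) (p : nat).
Hypothesis p_gt0 : (0 < p)%N.
Variables (a0 la : weight n) (m : int).
Hypothesis a0_highest : highest_short_root D a0.
Hypothesis la_dominant : dominant la.
Hypothesis m_level : level D p la a0 m.
Implicit Types (x y z t e g ga mu nu : weight n) (M N : group_ring n).
Local Notation "a '^v'" := (coroot D a) (at level 2, format "a '^v'").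
Local Notation s_ a := (root_reflection D a).
Local Notation al := (simple_root D).
Local Notation dot := (dot D).
Local Notation W := (fset_set (weyl D)).
Local Notation rho := (rho n).
Local Notation linked := (linked D p).

(** A chain from mu to la outside the orbit of mu has a first step that
    leaves this orbit. *)
Lemma linked_first mu : linked mu la ->
  weyl_orbit D mu la \/ exists x y, [/\ weyl_orbit D mu x,
    crossing D p (fun _ k => 0 <= k) x y, ~ weyl_orbit D mu y & linked y la].
Proof.
have orb x : weyl_orbit D x x by exists 1%:M; [constructor|rewrite mulmx1].
elim=> [x|x y z xy l IH]; first by left; apply: orb.
case: (pselect (weyl_orbit D x y)) => [[w Ww e]|no]; last first.
  by right; exists x, y; split.
have tr t : weyl_orbit D y t <-> weyl_orbit D x t.
  split=> -[u Wu <-].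
    by exists (w *m u); [apply: weylM|rewrite mulmxA e].
  exists (invmx w *m u); first by apply/weylM/Wu/weylV.
  by rewrite -e mulmxA (weylK _ Ww).
case: IH => [/tr|[x' [y' [/tr h1 h2 h3 h4]]]]; first by left.
by right; exists x', y'; split => // /tr.
Qed.

(** As e is fixed by u, t - t u is orthogonal to e, so it is a multiple of
    al i; as t and t u have the same norm, t u is t or its reflection. *)
Lemma stab_wall i e t u : strictly_dominant t -> weyl D u ->
  (forall j, j != i -> 0 < e 0 j) -> dominant e -> e *m u = e ->
  u = 1%:M \/ u = s_(al i).
Proof.
move=> ts Wu ej ed eu; have iR := simple_root_mem D i.
have [c ec] := dominant_sub (strictly_dominantW ts) Wu.
have et : dot e (t - t *m u) = 0 by rewrite dotBr -{2}eu dot_weyl // subrr.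
have cj j : j != i -> c j = 0%N.
  move=> ji; move: et; rewrite ec simple_natsum dot_sumr => /eqP.
  rewrite psumr_eq0 => [/allP /(_ j (mem_index_enum j))|k _]; last first.
    by rewrite dotZr mulr_ge0 // dot_simple_ge0.
  rewrite dotZr mulf_eq0 orbC gt_eqF ?dot_simple_gt0 ?ej //= => /eqP h.
  by case: h.
have tu : t *m u = t - (c i)%:Z *: al i.
  have -> : (c i)%:Z *: al i = t - t *m u.
    rewrite ec simple_natsum (bigD1 i) //= big1 ?addr0 // => j /cj ->.
    by rewrite scale0r.
  by rewrite opprB addrCA subrr addr0.
have : dot (t *m u) (t *m u) = dot t t by rewrite dot_weyl.
have := simple_dot D t i.
rewrite tu !dotBl !dotBr !dotZl !dotZr (dotC _ (al i) t) => e1 e2.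
have A0 := dot_root_gt0 iR.
have : (c i)%:Z * ((c i)%:Z - t 0 i) * dot (al i) (al i) = 0.
  rewrite mulrBr mulrBl -!mulrA -e1; move: e2.
  by move: (dot t t) (dot t _) (dot _ _) => X Y Z; lia.
move/eqP; rewrite mulf_eq0 [X in _ || X]gt_eqF // orbF mulf_eq0 => /orP[/eqP c0|].
  left; apply: (strictly_dominant_stab ts Wu).
  by rewrite tu c0 scale0r subr0.
rewrite subr_eq0 => /eqP c0; right; rewrite c0 -simple_refl in tu.
have := strictly_dominant_stab ts (weyl_mul iR Wu).
rewrite mulmxA tu -mulmxA reflK // mulmx1 => /(_ erefl) e3.
by rewrite -[LHS]mulmx1 -(reflK iR) mulmxA e3 mul1mx.
Qed.

(** Take the first step of a chain from mu to la and conjugate its root to -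
    al i. If the i-th coordinate of ga is k - 1 and all others are m - 1,
    only the terms of 1 and of the i-th simple reflection survive in the
    coefficient, which is M mu = 0 minus the value of M at the end of that
    step. *)
Lemma negative_coef M mu : weyl_invariant D M -> (forall x, M@_x != 0 -> linked x la) ->
  dominant mu -> linked mu la -> mu <> la -> M@_mu = 0 ->
  (forall nu, dominant nu -> linked nu la -> dominance D mu nu -> nu <> mu -> 0 < M@_nu) ->
  exists ga w, [/\ restricted m ga, weyl D w,
    strictly_dominant ((ga + rho) *+ p + mu *m w) &
    brauer_coef D M ((ga + rho) *+ p + mu *m w) ((ga + rho) *+ p) < 0].
Proof.
move=> Mi Ml mud mul mune M0 Mpos.
have m0 := level_gt0 p_gt0 a0_highest la_dominant m_level.
have bound := linked_bound p_gt0 a0_highest la_dominant m_level.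
have cbound := linked_coord p_gt0 a0_highest la_dominant m_level.
case: (linked_first mul) => [[w Ww e]|[x [y [[w1 W1 ex] [b [k [bR k0 xk ey]]] no yl]]]].
  by case: mune; rewrite -(dominant_unique mud Ww) e.
have lxm v : weyl D v -> linked (mu *m v) la.
  move=> Wv; rewrite -[la]mulmx1; apply: linked_weyl2 => //; constructor.
(* z and z' are the ends of the step after conjugation of b to - al i *)
have [w2 [i [W2 eb]]] := root_word (rootN bR).
have iR := simple_root_mem D i.
have {}eb : b *m w2 = - al i by rewrite -eb mulNmx opprK.
pose w := w1 *m w2; have Ww : weyl D w by apply: weylM.
pose z := mu *m w; pose z' := y *m w2.
have zE : z = x *m w2 by rewrite /z /w mulmxA ex.
have pz : pairing x b^v = - z 0 i.
  rewrite -(pairing_weyl x W2 bR) eb -zE corootN // pairingNr coroot_simple.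
  by rewrite pairing_delta.
have z'E : z' = z - (z 0 i + k * p%:Z) *: al i.
  rewrite /z' ey /affine_refl mulmxBl -scalemxAl eb pz -zE scalerN -scaleNr.
  by congr (_ - _ *: _); entry_lia.
have z'l : linked z' la by rewrite -[la]mulmx1; apply: linked_weyl2 => //; constructor.
have orb v : weyl D v -> ~ y = x *m v.
  move=> Wv e; apply: no; exists (w1 *m v); first exact: weylM.
  by rewrite mulmxA ex -e.
have lt : - z 0 i < k * p%:Z.
  rewrite lt_neqAle -pz xk andbT; apply/eqP => e.
  apply: (orb 1%:M); first by constructor.
  by rewrite mulmx1 ey /affine_refl e subrr scale0r subr0.
have {}k0 : 0 < k.
  rewrite lt_def k0 andbT; apply/eqP => e; apply: (orb (s_ b)); first exact: weyl_refl.
  by rewrite ey affine_reflE e mul0r scale0r addr0.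
have km : k < m.
  have := cbound z' i z'l; rewrite -pairing_delta z'E pairingBl pairingZl.
  rewrite -{2}(coroot_simple D) pairing_coroot // pairing_delta => h.
  have : k * p%:Z < m * p%:Z by move: h lt; rewrite (mulrC _ m); entry_lia.
  by rewrite ltr_pM2r.
pose ga : weight n := \row_j (if j == i then k - 1 else m - 1).
have gaE j : (ga + rho) 0 j = if j == i then k else m.
  by rewrite mxE rho_coord mxE; case: ifP; rewrite subrK.
have gr : restricted m ga.
  by apply/restrictedP => j; rewrite mxE; case: ifP => _; lia.
have gs : strictly_dominant (ga + rho).
  by move=> j; rewrite gaE; case: ifP.
set c := (ga + rho) *+ p.
have ts : strictly_dominant (c + z).
  move=> j; rewrite mxE /c mulrn_coord gaE; have := cbound z j (lxm _ Ww).
  by case: eqP => [->|_]; [move: lt; rewrite mulrC|]; entry_lia.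
exists ga, w; split => //; rewrite -/c -/z.
(* e marks the coordinates of ga that are large *)
pose e : weight n := \row_j (j != i)%:R.
have eE j : e 0 j = (j != i)%:R by rewrite mxE.
have ed : dominant e by move=> j; rewrite eE; case: (_ != _).
have term u : weyl D u -> u <> 1%:M -> u <> s_(al i) -> M@_((c + z) *m u - c) = 0.
  move=> Wu u1 us; apply: contrapT => /eqP/Ml l.
  have eu : e *m u = e.
    apply: (linked_stab p_gt0 a0_highest la_dominant m_level ed (strictly_dominantW gs)
      (strictly_dominantW ts) Wu _ l).
    by move=> j; rewrite eE gaE; case: (j == i).
  have ej j : j != i -> 0 < e 0 j by rewrite eE => ->.
  by case: (stab_wall ts Wu ej ed eu).
have s1 : s_(al i) != 1%:M.
  apply/eqP => s1; have := det_refl iR; rewrite s1 det1; lia.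
rewrite /brauer_coef (bigD1_seq 1%:M) ?fset_uniq //=; last by apply/in_W; constructor.
rewrite -big_filter (bigD1_seq (s_(al i))) ?filter_uniq ?fset_uniq //=; last first.
  by rewrite mem_filter s1; apply/in_W/weyl_refl.
rewrite big_seq_cond big1 ?addr0; last first.
  move=> u; rewrite mem_filter => /andP[/andP[/eqP u1 /in_W Wu] /eqP us].
  by rewrite term ?mulr0.
rewrite det1 mul1r mulmx1 det_refl // mulN1r.
have ez : c + z - c = z by rewrite addrAC subrr add0r.
have -> : (c + z) *m s_(al i) - c = z'.
  rewrite simple_refl addrAC ez z'E; congr (_ - _ *: _).
  by rewrite mxE /c mulrn_coord gaE eqxx mulrC addrC.
rewrite ez Mi // M0 add0r oppr_lt0.
have [v Wv yd] := dominant_conj D z'; rewrite -(Mi v Wv); apply: Mpos => //.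
- by rewrite -[la]mulmx1; apply: linked_weyl2 => //; constructor.
- apply: (@up_dominance _ _ p); apply: linked_up => //.
  apply: chain_trans (linked_weyl p mu W1) _; rewrite ex /z' -mulmxA.
  apply: chain_trans _ (linked_weyl p y (weylM W2 Wv)).
  by apply: chain1; exists b, k; split => //; apply: ltW.
move=> ev; apply: no; exists (invmx (w2 *m v)).
  by apply/weylV/weylM.
by rewrite -ev /z' -(mulmxA y) (weylK _ (weylM W2 Wv)).
Qed.

End Negativity.

(** * The algorithm *)

Section Algorithm.
Variables (n : nat) (D : root_datum n) (p : nat).
Hypothesis p_gt0 : (0 < p)%N.
Variables (a0 la : weight n).
Hypothesis a0_highest : highest_short_root D a0.
Hypothesis la_dominant : dominant la.
Implicit Types (x y z t g ga mu nu : weight n) (M N : group_ring n).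
Local Notation dot := (dot D).
Local Notation rho := (rho n).
Local Notation linked := (linked D p).
Local Notation Psi := (Psi D p la).

Lemma PsiE mu : Psi mu <-> dominant mu /\ linked mu la.
Proof. exact: PsiP. Qed.

Lemma finite_Psi : finite_set Psi.
Proof.
apply: (@sub_finite_set _ _ (@restricted n (dot la la + 1))); last exact: finite_restricted.
move=> x /PsiE [xd l]; apply/restrictedP => i; rewrite xd /=.
have := linked_norm p_gt0 la_dominant l; have := le_sqr_coord D x i; have := xd i.
by move: (x 0 i) (dot _ _) (dot _ _) => k X Y; nia.
Qed.

Lemma level_exists : exists m, level D p la a0 m.
Proof.
have h : 0 < p%:Z by [].
exists ((pairing la (coroot D a0) %/ p%:Z)%Z + 1); split => [|k /=].
  have := ltz_pmod (pairing la (coroot D a0)) h.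
  have := divz_eq (pairing la (coroot D a0)) p%:Z => /=; nia.
have := modz_ge0 (pairing la (coroot D a0)) (lt0r_neq0 h).
have := divz_eq (pairing la (coroot D a0)) p%:Z => /=; nia.
Qed.

Variable m : int.
Hypothesis m_level : level D p la a0 m.

Lemma level_unique k : level D p la a0 k -> k = m.
Proof.
move=> [k1 k2]; have [m1 m2] := m_level; apply/eqP.
by rewrite eq_le (k2 _ m1) (m2 _ k1).
Qed.

Definition supported M := weyl_invariant D M /\ forall x, M@_x != 0 -> linked x la.

Lemma inspectedP M mu v : weyl_invariant D M ->
  inspected_coefs D p m M mu v <-> exists ga w, [/\ restricted m ga, weyl D w,
    strictly_dominant ((ga + rho) *+ p + mu *m w) &
    v = brauer_coef D M ((ga + rho) *+ p + mu *m w) ((ga + rho) *+ p)].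
Proof.
have E ga w : steinberg_weight p ga + mu *m w + rho = (ga + rho) *+ p + mu *m w.
  by rewrite addrAC steinberg_rho.
have gd ga : restricted m ga -> dominant ga.
  by move=> /restrictedP h i; case/andP: (h i).
move=> Mi; split=> -[ga [w [gr Ww d ->]]]; exists ga, w; split => //.
- by rewrite -E; apply/dominant_rho.
- by rewrite (brauerC _ _ (gd _ gr)) // E.
- by apply/dominant_rho; rewrite E.
have d' : dominant (steinberg_weight p ga + mu *m w) by apply/dominant_rho; rewrite E.
by rewrite (brauerC _ _ (gd _ gr)) // E.
Qed.

Lemma inspected_finite M mu : finite_set (inspected_coefs D p m M mu).
Proof.
pose f q := basis_coef (weyl_char D) (gmul (weyl_char D (steinberg_weight p q.1)) M)
  (steinberg_weight p q.1 + mu *m q.2).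
apply: (@sub_finite_set _ _ (f @` (@restricted n m `*` weyl D))).
  by move=> v [ga [w [gr Ww _ ->]]]; exists (ga, w).
by apply/finite_image/finite_setX; [exact: finite_restricted|exact: finite_weyl].
Qed.

Lemma inspected_nonempty M mu : dominant mu -> inspected_coefs D p m M mu !=set0.
Proof.
move=> mud; have m0 := level_gt0 p_gt0 a0_highest la_dominant m_level.
exists (basis_coef (weyl_char D) (gmul (weyl_char D (steinberg_weight p 0)) M)
  (steinberg_weight p 0 + mu *m 1%:M)).
exists 0, 1%:M; split => //.
- by apply/restrictedP => i; rewrite mxE lexx.
- exact: weyl1.
rewrite mulmx1; have d0 : dominant (0 : weight n) by move=> i; rewrite mxE.
by move=> i; rewrite mxE addr_ge0 // (steinberg_dominant p_gt0 d0).
Qed.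

(** By brauer_coef_eq the inspected coefficients at mu depend on the
    coefficients strictly above mu, and additively on the coefficient at mu. *)
Lemma inspected_shift M N mu v : weyl_invariant D M -> weyl_invariant D N ->
  (forall z, linked mu z -> dot mu mu < dot z z -> M@_z = N@_z) ->
  inspected_coefs D p m M mu v -> inspected_coefs D p m N mu (v + (N@_mu - M@_mu)).
Proof.
move=> Mi Ni h /(inspectedP _ _ Mi) [ga [w [gr Ww ts ->]]]; apply/(inspectedP _ _ Ni).
exists ga, w; split => //.
have gs : strictly_dominant (ga + rho).
  by apply/dominant_rho => i; have /restrictedP/(_ i)/andP[] := gr.
have := @brauer_coef_eq n D p p_gt0 M N _ _ gs ts.
rewrite Mi // Ni // => /(_ _)/wrap[].
  move=> z l; rewrite dot_weyl //; apply: h.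
  by apply: chain_trans (linked_weyl p mu Ww) l.
by move: (brauer_coef D M _ _) (brauer_coef D N _ _) (M@_mu) (N@_mu) => i j k l; lia.
Qed.

(** The invariant of the algorithm. The weights already present form an
    upper set of Psi, so no later step changes the coefficients inspected at
    one of them, whose minimum stays 0. *)
Definition sound M := [/\ supported M, M@_la = 1,
  forall mu nu, Psi mu -> Psi nu -> dominance D mu nu -> M@_mu != 0 -> M@_nu != 0 &
  forall mu, Psi mu -> M@_mu != 0 ->
    0 < M@_mu /\ (mu <> la -> is_least (inspected_coefs D p m M mu) 0)].

Lemma missingP M mu : weyl_invariant D M ->
  missing D p la M mu <-> Psi mu /\ M@_mu = 0.
Proof.
move=> Mi; split=> -[Pmu e]; have [mud _] := (PsiE mu).1 Pmu; split => //.
  by rewrite -(basis_coef_orbit Mi mud).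
by rewrite (basis_coef_orbit Mi mud).
Qed.

Lemma Psi_la : Psi la.
Proof. by apply/PsiE; split => //; apply: chain_refl. Qed.

Lemma Psi_top nu : Psi nu -> dominance D la nu -> nu = la.
Proof. by move=> /Psi_dominance h1 h2; apply: dominance_anti h1 h2. Qed.

Lemma sound_init : sound (orbit_sum D la).
Proof.
have one : (orbit_sum D la)@_la = 1 by rewrite orbit_dominant // eqxx.
have eq_la mu : Psi mu -> (orbit_sum D la)@_mu != 0 -> mu = la.
  move=> /PsiE [mud _]; rewrite orbit_dominant //; by case: (eqVneq la mu) => [->|]; rewrite ?eqxx.
split => //.
- split=> [|x]; first exact: orbit_invariant.
  rewrite orbitE; case: asboolP => [[w Ww <-] _|]; last by rewrite eqxx.
  rewrite -[X in linked _ X](weylK la Ww).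
  by apply: linked_weyl; apply: weylV.
- move=> mu nu Pmu Pnu le /(eq_la _ Pmu) e.
  by rewrite e in le; rewrite (Psi_top Pnu le) one.
by move=> mu Pmu /(eq_la _ Pmu) ->; rewrite one; split.
Qed.

Lemma linked_dominance mu nu : dominant mu -> dominant nu -> linked mu nu -> dominance D mu nu.
Proof. by move=> d d' l; apply: (@up_dominance _ _ p); apply: linked_up. Qed.

(** Were the minimum 0, the iteration would change nothing and the algorithm
    would not stop. *)
Lemma least_negative M mu (x : int) : sound M -> choosable D p la M mu ->
  is_least (inspected_coefs D p m M mu) x -> x < 0.
Proof.
move=> [[Mi Ml] Mla _ Mpos] [mis max] [_ least].
have [Pmu M0] := (missingP mu Mi).1 mis; have [mud mul] := (PsiE mu).1 Pmu.
have mune : mu <> la by move=> e; move: M0; rewrite e Mla.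
have [|ga [w [gr Ww ts neg]]] :=
  negative_coef p_gt0 a0_highest la_dominant m_level Mi Ml mud mul mune M0.
  move=> nu nud nul le ne; have Pnu : Psi nu by apply/PsiE.
  apply: (Mpos _ Pnu _).1; apply/eqP => N0; apply: ne; apply: max => //.
  exact/(missingP nu Mi).
apply: le_lt_trans neg; apply: least; apply/(inspectedP _ _ Mi).
by exists ga, w.
Qed.

Lemma iteration_exists M mu : sound M -> choosable D p la M mu ->
  exists M', iteration_at D p la a0 mu M M'.
Proof.
move=> [[Mi _] _ _ _] [/(missingP mu Mi) [/PsiE [mud _] _] _].
have [x xl] := finite_least (inspected_finite M mu) (inspected_nonempty M mud).
by exists (M - x *: orbit_sum D mu), m, x.
Qed.

Lemma iteration_sound M M' mu : sound M -> choosable D p la M mu ->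
  iteration_at D p la a0 mu M M' ->
  [/\ sound M', M'@_mu != 0 & forall nu, Psi nu -> M@_nu != 0 -> M'@_nu != 0].
Proof.
move=> Ms ch [k [x [/level_unique -> xl eM']]] {k}.
have x0 := least_negative Ms ch xl.
have [[Mi Ml] Mla Mup Mpos] := Ms; have [mis max] := ch.
have [Pmu M0] := (missingP mu Mi).1 mis; have [mud mul] := (PsiE mu).1 Pmu.
have mune : mu <> la by move=> e; move: M0; rewrite e Mla.
have M'E z : M'@_z = M@_z - x * (orbit_sum D mu)@_z.
  rewrite eM'; apply: etrans (mcoeffB _ _ _) _; congr (_ - _); exact: mcoeffZ.
have M'd nu : dominant nu -> M'@_nu = M@_nu - x * (mu == nu)%:R.
  by move=> d; rewrite M'E orbit_dominant.
have M'mu : M'@_mu = - x by rewrite M'd // eqxx M0 mulr1 sub0r.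
have M'ne nu : Psi nu -> nu <> mu -> M'@_nu = M@_nu.
  move=> /PsiE [nud _] ne; rewrite M'd //; case: eqP => [e|_]; last by rewrite mulr0 subr0.
  by case: ne.
have keep nu : Psi nu -> M@_nu != 0 -> nu <> mu by move=> _ + e; rewrite e M0 eqxx.
have M'i : weyl_invariant D M'.
  by move=> w Ww z; rewrite !M'E Mi // (@orbit_invariant n D mu w Ww).
have orb0 z : ~ weyl_orbit D mu z -> M'@_z = M@_z.
  by move=> no; rewrite M'E orbitE asboolF // mulr0 subr0.
split; last 2 first.
- by rewrite M'mu oppr_eq0 lt_eqF.
- by move=> nu Pnu nz; rewrite M'ne //; apply: keep.
split.
- split => // z; case: (pselect (weyl_orbit D mu z)) => [[w Ww <-] _|/orb0 ->]; last exact: Ml.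
  by rewrite -[la]mulmx1; apply: linked_weyl2 => //; exact: weyl1.
- by rewrite M'ne //; [exact: Psi_la|move=> e; apply: mune].
- move=> mu1 nu P1 P2 le nz; case: (pselect (nu = mu)) => [->|ne].
    by rewrite M'mu oppr_eq0 lt_eqF.
  rewrite M'ne //; case: (pselect (mu1 = mu)) => [e|ne1]; last first.
    by rewrite M'ne // in nz; apply: Mup le nz.
  apply/eqP => N0; apply: ne; apply: max; last by rewrite -e.
  exact/(missingP nu Mi).
move=> mu1 P1; have [d1 l1] := (PsiE mu1).1 P1.
case: (pselect (mu1 = mu)) => [->|ne1].
  rewrite M'mu oppr_gt0 => _; split; first exact: x0.
  move=> _; case: xl => xin xmin.
  have same z : linked mu z -> dot mu mu < dot z z -> M@_z = M'@_z.
    move=> _ lt; rewrite orb0 // => -[w Ww e].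
    by move: lt; rewrite -e dot_weyl // ltxx.
  split.
    have := inspected_shift Mi M'i same xin.
    by rewrite M'mu M0 subr0 subrr.
  move=> y yin; have := inspected_shift M'i Mi (fun z l h => esym (same z l h)) yin.
  by move=> /xmin; rewrite M'mu M0; lia.
rewrite (M'ne _ P1 ne1) => nz; have [pos least] := Mpos _ P1 nz.
split; first exact: pos.
move=> /least [xin xmin].
have same z : linked mu1 z -> M@_z = M'@_z.
  move=> l; rewrite orb0 // => -[w Ww e].
  have l' : linked mu1 mu.
    by apply: chain_trans l _; rewrite -e -{2}(weylK mu Ww); apply/linked_weyl/weylV.
  by have := Mup _ _ P1 Pmu (linked_dominance d1 mud l') nz; rewrite M0 eqxx.
have e1 := M'ne _ P1 ne1.
split.
  have := inspected_shift Mi M'i (fun z l _ => same z l) xin.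
  by rewrite e1 subrr addr0.
move=> y yin; have := inspected_shift M'i Mi (fun z l _ => esym (same z l)) yin.
by rewrite e1 subrr addr0 => /xmin.
Qed.

Lemma reachable_sound M : reachable D p la a0 M -> sound M.
Proof.
elim=> [|{}M M' _ Ms [mu ch it]]; first exact: sound_init.
by have [] := iteration_sound Ms ch it.
Qed.

Definition missing_count M := count (fun mu => M@_mu == 0) (fset_set Psi).

Lemma in_Psi mu : mu \in fset_set Psi <-> Psi mu.
Proof. by rewrite in_fset_set ?inE //; apply: finite_Psi. Qed.

Lemma iteration_count M M' : sound M -> iteration D p la a0 M M' ->
  sound M' /\ (missing_count M' < missing_count M)%N.
Proof.
move=> Ms [mu ch it]; have [M's M'mu keep] := iteration_sound Ms ch it; split => //.
have [[Mi _] _ _ _] := Ms; have [Pmu M0] := (missingP mu Mi).1 ch.1.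
apply: (count_lt (x := mu)) => //; [|exact/in_Psi|exact/eqP].
by move=> nu /in_Psi Pnu; apply: contraTT; apply: keep.
Qed.

Lemma sound_Acc M : sound M -> Acc (fun M' M => iteration D p la a0 M M') M.
Proof.
have [k] := ubnP (missing_count M); elim: k M => [|k IH] M; first by rewrite ltn0.
rewrite ltnS => lt Ms; constructor => M' /(iteration_count Ms) [M's lt'].
exact: IH (leq_trans lt' lt) M's.
Qed.

Lemma choosable_exists M : sound M -> missing D p la M !=set0 ->
  exists mu, choosable D p la M mu.
Proof.
move=> [[Mi _] _ _ _] [mu0 /(missingP mu0 Mi) [P0 M0]].
pose s := [seq mu <- fset_set Psi | M@_mu == 0].
have sP mu : mu \in s <-> missing D p la M mu.
  rewrite mem_filter missingP //; split=> [/andP[/eqP e /in_Psi]|[Pm /eqP ->]] //=.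
  exact/in_Psi.
have [mu mus mumax] := seq_argmax (dot rho) ((sP mu0).2 ((missingP mu0 Mi).2 (conj P0 M0))).
exists mu; split; first exact/sP.
move=> nu mis le; apply: contrapT => ne.
have := dominance_dot_lt (@rho_strict n) le (fun e => ne (esym e)).
by rewrite ltNge mumax //; apply/sP.
Qed.

Lemma final_exists M : reachable D p la a0 M ->
  exists N, reachable D p la a0 N /\ missing D p la N = set0.
Proof.
have [k] := ubnP (missing_count M); elim: k M => [|k IH] M; first by rewrite ltn0.
rewrite ltnS => lt Mr; have Ms := reachable_sound Mr.
case: (pselect (missing D p la M !=set0)) => [|/set0P/negP/negPn/eqP]; last by exists M.
move=> /(choosable_exists Ms) [mu ch]; have [M' it] := iteration_exists Ms ch.
have it' : iteration D p la a0 M M' by exists mu.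
have [_ lt'] := iteration_count Ms it'.
exact: IH (leq_trans lt' lt) (reachable_next Mr it').
Qed.

Lemma not_missing M : sound M -> missing D p la M = set0 -> forall mu, Psi mu -> M@_mu != 0.
Proof.
move=> [[Mi _] _ _ _] none mu Pmu; apply/eqP => M0.
have : missing D p la M mu by apply/(missingP mu Mi).
by rewrite none.
Qed.

(** Induction from la downwards for the norm: once M and N agree above x,
    their inspected coefficients at x differ by N x - M x, and both minima
    are 0. *)
Lemma final_unique M N : sound M -> sound N ->
  missing D p la M = set0 -> missing D p la N = set0 -> M = N.
Proof.
move=> Ms Ns M0 N0; have [Mn Nn] := (not_missing Ms M0, not_missing Ns N0).
have [[Mi Ml] Mla _ Mmin] := Ms; have [[Ni Nl] Nla _ Nmin] := Ns.
have unlinked x : ~ linked x la -> M@_x = N@_x.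
  move=> nl; transitivity (0 : int); last apply: esym.
    by apply: contrapT => /eqP/Ml.
  by apply: contrapT => /eqP/Nl.
apply: (dominant_agree Mi Ni) => x xd.
have [k] := ubnP `|dot la la - dot x x|; elim: k x xd => // k IH x xd lt_k.
case: (pselect (linked x la)) => [l|/unlinked //].
have Px : Psi x by apply/PsiE.
case: (pselect (x = la)) => [->|ne]; first by rewrite Mla Nla.
have same z : linked x z -> dot x x < dot z z -> M@_z = N@_z.
  move=> _ lt; case: (pselect (linked z la)) => [lz|/unlinked //].
  have [w Ww zd] := dominant_conj D z; rewrite -(Mi w Ww) -(Ni w Ww); apply: IH => //.
  rewrite dot_weyl //; have := linked_norm p_gt0 la_dominant lz; lia.
have [_ /(_ ne) [m1 m2]] := Mmin _ Px (Mn _ Px).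
have [_ /(_ ne) [n1 n2]] := Nmin _ Px (Nn _ Px).
have := n2 _ (inspected_shift Mi Ni same m1).
have := m2 _ (inspected_shift Ni Mi (fun z l h => esym (same z l h)) n1).
by move: (M@_x) (N@_x) => a b; lia.
Qed.

(** A coefficient of a product is 0 if its weight y is not linked to la, 1
    if y is in the orbit of la, and otherwise is one of the inspected
    coefficients after truncation of ga. *)
Lemma final_good N : sound N -> missing D p la N = set0 ->
  good_steinberg_multiplication D p N.
Proof.
move=> Ns none; have Nn := not_missing Ns none.
have [[Ni Nl] Nla _ Nmin] := Ns; split => // ga gd.
have gs : strictly_dominant (ga + rho) by apply/dominant_rho.
set c := (ga + rho) *+ p.
have unlinked y : strictly_dominant (c + y) -> ~ linked y la ->
    brauer_coef D N (c + y) c = 0.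
  move=> ts nl; have := @brauer_coef_eq n D p p_gt0 N 0 _ _ gs ts.
  have Ny z : linked y z -> N@_z = 0.
    move=> l; apply: contrapT => /eqP /Nl l'; apply: nl.
    exact: chain_trans l l'.
  rewrite (Ny y (chain_refl _ _)) mcoeff0 !subr0 => ->.
    by rewrite /brauer_coef big1 // => u _; rewrite mcoeff0 mulr0.
  by move=> z /Ny -> _; rewrite mcoeff0.
have top y : strictly_dominant (c + y) -> weyl_orbit D la y ->
    brauer_coef D N (c + y) c = 1.
  move=> ts [w Ww ey]; have := @brauer_coef_eq n D p p_gt0 N 0 _ _ gs ts.
  have -> : brauer_coef D 0 (c + y) c = 0.
    by rewrite /brauer_coef big1 // => u _; rewrite mcoeff0 mulr0.
  rewrite mcoeff0 subr0 -ey Ni // Nla => /(_ _)/wrap[]; last first.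
    by move/eqP; rewrite subr_eq0 => /eqP.
  move=> z _; rewrite dot_weyl // mcoeff0 => lt; apply: contrapT => /eqP /Nl l.
  by have := linked_norm p_gt0 la_dominant l; rewrite leNgt lt.
have coefE nu : dominant nu ->
    basis_coef (weyl_char D) (gmul N (weyl_char D (steinberg_weight p ga))) nu =
    brauer_coef D N (nu + rho) c by move=> nud; apply: brauer.
have [ci _] := weyl_charP D (steinberg_dominant p_gt0 gd).
have Gi : weyl_invariant D (gmul N (weyl_char D (steinberg_weight p ga))).
  by rewrite gmul_conv; apply: conv_invariant.
have ts0 : strictly_dominant (c + la).
  move=> i; have := strictly_dominantMn p_gt0 gs i; have := la_dominant i.
  by rewrite mxE -/c; entry_lia.
have cE y : c + y - rho + rho = c + y by rewrite subrK.
split => //.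
  apply/eqP => G0; have nud : dominant (c + la - rho) by apply/dominant_rho; rewrite cE.
  have := coefE _ nud; rewrite cE top //; last by exists 1%:M; rewrite ?mulmx1 //; apply: weyl1.
  rewrite basis_coef_weyl // gmul_conv.
  rewrite gmul_conv in G0; rewrite G0 conv0l mcoeff0 => /esym/eqP.
  by rewrite oner_eq0.
move=> nu nud; rewrite coefE //; pose y := nu + rho - c.
have ey : nu + rho = c + y by rewrite [RHS]addrC /y subrK.
have ts : strictly_dominant (c + y) by rewrite -ey; apply/dominant_rho.
rewrite ey; case: (pselect (linked y la)) => [l|nl]; last by rewrite unlinked.
have [w Ww mud] := dominant_conj D y.
have Pmu : Psi (y *m w).
  by apply/PsiE; split => //; rewrite -[la]mulmx1; apply: linked_weyl2 => //; exact: weyl1.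
have yE : y = y *m w *m invmx w by rewrite (weylK _ Ww).
case: (pselect (y *m w = la)) => [e|ne].
  by rewrite top // yE e; exists (invmx w) => //; apply: weylV.
have [gb [gr ts' ->]] := brauer_coef_reduce p_gt0 a0_highest la_dominant m_level Nl gd ts l.
have [_ /(_ ne) [_ least]] := Nmin _ Pmu (Nn _ Pmu); apply: least.
apply/(inspectedP _ _ Ni); exists gb, (invmx w); rewrite -yE; split => //.
exact: weylV.
Qed.

End Algorithm.

Theorem mainTheorem8 (p : nat) (n : nat) (D : root_datum n) (a0 : weight n)
    (p_prime : prime p) (a0_highest : highest_short_root D a0)
    (la : weight n) (la_dominant : dominant la) :
  algorithm_terminates D p la a0 /\
  exists N : group_ring n,
    [/\ weyl_invariant D N,
        forall M, algorithm_returns D p la a0 M <-> M = N &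
        good_steinberg_multiplication D p N].
Proof.
have p_gt0 := prime_gt0 p_prime.
have [m m_level] := level_exists D p_gt0 a0 la.
have sound_of := reachable_sound p_gt0 a0_highest la_dominant m_level.
have init := sound_init D p_gt0 la_dominant m.
split.
  split.
  - exact (sound_Acc p_gt0 a0_highest la_dominant m_level init).
  - move=> M mu /sound_of Ms ch.
    exact (iteration_exists p_gt0 a0_highest la_dominant m_level Ms ch).
  - exact: finite_Psi.
  - exact: finite_weyl.
  - by move=> k _; apply: finite_restricted.
have [N [Nr N0]] :=
  final_exists p_gt0 a0_highest la_dominant m_level (reachable_init D p la a0).
have Ns := sound_of _ Nr; exists N; split.
- by case: Ns => [[]].
- move=> M; split=> [[Mr M0]|->]; last by [].
  exact (final_unique p_gt0 la_dominant (sound_of _ Mr) Ns M0 N0).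
exact (final_good p_gt0 a0_highest la_dominant m_level Ns N0).
Qed.
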